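(* Let $\rho \ge 1$ be such that there is a polynomial-time $\rho$-approximation algorithm for the Steiner Minimum Tree problem on metric graphs. Then there is a polynomial-time algorithm which, given any instance $(G,R)$ of the Internal Steiner Minimum Tree problem, outputs a feasible solution (a Steiner tree of $G$ spanning $R$ in which no vertex of $R$ is a leaf) whose total weight is at most $2\rho$ times the minimum weight of a feasible solution. That is, ISMT can be $2\rho$-approximated in polynomial time.
   Context: A metric graph is a complete undirected graph with nonnegative edge weights $w$ satisfying the triangle inequality. For a graph $G=(V,E)$ and $R\subset V$, a Steiner tree is a connected acyclic subgraph of $G$ containing all vertices of $R$; its weight is the sum of the weights of its edges. The Steiner Minimum Tree problem (SMT): given $(G,R)$, find a Steiner tree of minimum weight. The Internal Steiner Minimum Tree problem (ISMT): given a metric graph $G=(V,E)$ and $R\subset V$ with $|V\setminus R|\ge 2$, find a minimum-weight Steiner tree spanning $R$ such that every vertex of $R$ is not a leaf of the tree. *)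

(* Defs.v *)
From mathcomp Require Import all_boot all_order all_algebra.
From mathcomp Require Import reals.

Set Implicit Arguments.
Unset Strict Implicit.
Unset Printing Implicit Defensive.

Import Order.TTheory GRing.Theory Num.Theory.

(* Model of computation: while-programs over binary trees of cons cells whose
   leaves are natural numbers, under the bit-cost (logarithmic) measure.  Every
   evaluated subexpression is charged the bit size of its value, so a run of
   cost t only builds values of size at most t, and each primitive acts in
   polynomial time on the binary representations of its operands.  Hence
   "polynomial time" here is polynomial time on Turing machines. *)

Inductive value : Type :=
| Atom of nat
| Pair of value & value.

Fixpoint bitsize (v : value) : nat :=
  match v with
  | Atom n => (trunc_log 2 n).+1
  | Pair a b => (bitsize a + bitsize b).+1
  end.

Inductive expr : Type :=
| Var of nat
| Const of nat
| Cons of expr & expr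
| Hd of expr
| Tl of expr
| IsPair of expr
| Add of expr & expr
| Sub of expr & expr
| Mul of expr & expr
| Leq of expr & expr.

Inductive cmd : Type :=
| Skip
| Assign of nat & expr
| Seq of cmd & cmd
| If of expr & cmd & cmd
| While of expr & cmd.

Definition store : Type := nat -> value.

(* Primitives are total: a pair counts as 0 in arithmetic, and a number has
   head and tail 0. *)
Definition val_num (v : value) : nat := if v is Atom n then n else 0.
Definition val_hd (v : value) : value := if v is Pair a _ then a else Atom 0.
Definition val_tl (v : value) : value := if v is Pair _ b then b else Atom 0.
Definition is_pair (v : value) : bool := if v is Pair _ _ then true else false.
Definition truthy (v : value) : bool := if v is Atom 0 then false else true.

Fixpoint eval (s : store) (e : expr) : value :=
  match e with
  | Var x => s x
  | Const n => Atom n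
  | Cons a b => Pair (eval s a) (eval s b)
  | Hd a => val_hd (eval s a)
  | Tl a => val_tl (eval s a)
  | IsPair a => Atom (is_pair (eval s a))
  | Add a b => Atom (val_num (eval s a) + val_num (eval s b))
  | Sub a b => Atom (val_num (eval s a) - val_num (eval s b))
  | Mul a b => Atom (val_num (eval s a) * val_num (eval s b))
  | Leq a b => Atom (val_num (eval s a) <= val_num (eval s b))
  end.

Fixpoint eval_cost (s : store) (e : expr) : nat :=
  bitsize (eval s e) +
  match e with
  | Var _ | Const _ => 0
  | Hd a | Tl a | IsPair a => eval_cost s a
  | Cons a b | Add a b | Sub a b | Mul a b | Leq a b =>
      eval_cost s a + eval_cost s b
  end.

Definition update (s : store) (x : nat) (v : value) : store :=
  fun y => if y == x then v else s y.

(* [exec c s t s']: from store [s], the program [c] halts in store [s'] after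
   time exactly [t]. *)
Inductive exec : cmd -> store -> nat -> store -> Prop :=
| exec_skip s :
    exec Skip s 1 s
| exec_assign s x e :
    exec (Assign x e) s (eval_cost s e).+1 (update s x (eval s e))
| exec_seq s s1 s2 t1 t2 c1 c2 :
    exec c1 s t1 s1 -> exec c2 s1 t2 s2 ->
    exec (Seq c1 c2) s (t1 + t2).+1 s2
| exec_if s s1 t e c1 c2 :
    exec (if truthy (eval s e) then c1 else c2) s t s1 ->
    exec (If e c1 c2) s (eval_cost s e + t).+1 s1
| exec_while_stop s e c :
    ~~ truthy (eval s e) ->
    exec (While e c) s (eval_cost s e).+1 s
| exec_while_step s s1 s2 t1 t2 e c :
    truthy (eval s e) ->
    exec c s t1 s1 -> exec (While e c) s1 t2 s2 ->
    exec (While e c) s (eval_cost s e + t1 + t2).+1 s2.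

(* Variable 0 holds the input at the start and the output at the end; all other
   variables start at 0. *)
Definition runs (c : cmd) (input : value) (t : nat) (output : value) : Prop :=
  exists2 s : store,
    exec c (fun x => if x == 0 then input else Atom 0) t s & s 0 = output.

Record subgraph (V : finType) := Subgraph {
  verts : {set V};
  edges : {set {set V}}
}.

Definition adj (V : finType) (T : subgraph V) : rel V :=
  fun x y => [set x; y] \in edges T.

(* Subgraph of the complete graph on V: its edges are two-element sets. *)
Definition is_subgraph (V : finType) (T : subgraph V) : Prop :=
  forall e, e \in edges T -> #|e| = 2 /\ e \subset verts T.

Definition connected (V : finType) (T : subgraph V) : Prop :=
  verts T != set0 /\ {in verts T &, forall x y, connect (adj T) x y}.

(* A [ucycle] [:: x; y] merely goes back and forth along one edge; the cycles
   of a simple graph have length at least 3. *)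
Definition acyclic (V : finType) (T : subgraph V) : Prop :=
  forall c : seq V, ucycle (adj T) c -> size c <= 2.

Definition degree (V : finType) (T : subgraph V) (x : V) : nat :=
  #|[set e in edges T | x \in e]|.

Definition leaf (V : finType) (T : subgraph V) (x : V) : Prop :=
  x \in verts T /\ degree T x = 1.

Definition steiner_tree (V : finType) (R : {set V}) (T : subgraph V) : Prop :=
  [/\ is_subgraph T, connected T, acyclic T & R \subset verts T].

Local Open Scope ring_scope.

(* Edge weights are given as a function on sets of vertices, of which only the
   values on two-element sets are meaningful. *)
Definition metric (V : finType) (w : {set V} -> rat) : Prop :=
  (forall x y : V, x != y -> 0 <= w [set x; y]) /\
  (forall x y z : V, x != y -> y != z -> x != z ->
     w [set x; z] <= w [set x; y] + w [set y; z]).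

Definition weight (V : finType) (w : {set V} -> rat) (T : subgraph V) : rat :=
  \sum_(e in edges T) w e.

Record instance := Instance {
  nverts : nat;
  edge_weight : {set 'I_nverts} -> rat;
  terminals : {set 'I_nverts}
}.

Record min_problem := MinProblem {
  valid : instance -> Prop;
  feasible : forall I : instance, subgraph 'I_(nverts I) -> Prop
}.

Definition SMT : min_problem := {|
  valid := fun I => (0 < nverts I)%N /\ metric (@edge_weight I);
  feasible := fun I T => steiner_tree (terminals I) T
|}.

Definition ISMT : min_problem := {|
  valid := fun I => metric (@edge_weight I) /\ (2 <= #|~: terminals I|)%N;
  feasible := fun I T =>
    steiner_tree (terminals I) T /\ {in terminals I, forall x, ~ leaf T x}
|}.

Definition optimal (Pb : min_problem) (I : instance)
    (T : subgraph 'I_(nverts I)) : Prop :=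
  feasible Pb T /\
  forall T' : subgraph 'I_(nverts I), feasible Pb T' ->
    weight (@edge_weight I) T <= weight (@edge_weight I) T'.

Definition enc_seq (A : Type) (f : A -> value) (s : seq A) : value :=
  foldr (fun a v => Pair (f a) v) (Atom 0) s.

(* Only used on nonnegative rationals, written in lowest terms. *)
Definition enc_rat (q : rat) : value := Pair (Atom `|numq q|%N) (Atom `|denq q|%N).

(* Number of vertices, weight matrix (with zero diagonal), and characteristic
   vector of the terminals. *)
Definition enc_instance (I : instance) : value :=
  let n := nverts I in
  Pair (Atom n)
    (Pair
      (enc_seq (fun i : 'I_n =>
         enc_seq (fun j : 'I_n =>
           enc_rat (if i == j then 0 else edge_weight [set i; j]))
         (enum 'I_n)) (enum 'I_n))
      (enc_seq (fun i : 'I_n => Atom (i \in terminals I)) (enum 'I_n))).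

(* An output is a list of vertices and a list of edges, each edge a pair of
   endpoints, in any order and with repetitions allowed. *)
Definition represents (n : nat) (v : value) (T : subgraph 'I_n) : Prop :=
  exists (vs : seq 'I_n) (es : seq ('I_n * 'I_n)),
    [/\ v = Pair (enc_seq (fun i : 'I_n => Atom i) vs)
                 (enc_seq (fun e : 'I_n * 'I_n => Pair (Atom e.1) (Atom e.2)) es),
        verts T = [set x in vs]
      & edges T = [set:: [seq [set e.1; e.2] | e <- es]]].

Definition poly_time_approx (R : realType) (Pb : min_problem) (rho : R) : Prop :=
  exists (P : cmd) (c k : nat), forall I : instance, valid Pb I ->
    exists (t : nat) (v : value) (T : subgraph 'I_(nverts I)),
      [/\ runs P (enc_instance I) t v,
          (t <= c * bitsize (enc_instance I) ^ k + c)%N,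
          represents v T,
          feasible Pb T
        & forall Topt : subgraph 'I_(nverts I), optimal Pb Topt ->
            ratr (weight (@edge_weight I) T)
              <= rho * ratr (weight (@edge_weight I) Topt)].

(* Main.v *)
Require Import Defs.
From mathcomp Require Import all_boot all_order all_algebra.
From mathcomp Require Import reals.
From mathcomp Require Import boolp.
From mathcomp Require Import zify lra.

(* Let T be a Steiner tree for R found by the given algorithm.  The core S of a
   feasible tree U, obtained by pruning the leaves outside R, is a Steiner tree
   for R; if |R| >= 2, it has two leaves r1, r2, which lie in R and are not
   leaves of U, so they have neighbours x1, x2 in U outside S.  These are
   distinct nonterminals, for otherwise U would contain a cycle, and hence
   w(U) >= w(S) + w(r1 x1) + w(r2 x2).  So the algorithm chooses r1, x1, r2, x2
   minimising w(r1 x1) + w(r2 x2), computes from T a Hamiltonian path from r1 to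
   r2 of weight at most 2 w(T) by shortcutting a doubled tree, and extends it
   by x1 and x2; the leaves of the result are x1 and x2.

   Polynomial time is obtained from a class of functions on values that is
   closed under pairing, composition, case distinction and folds over lists. *)

Set Implicit Arguments.
Unset Strict Implicit.
Unset Printing Implicit Defensive.

Import Order.TTheory GRing.Theory Num.Theory.

(** * Polynomial bounds *)

(** Where the ratio comes from: let S be the core of an optimal tree, d the weight of its two
    pendant edges and d' that of the cheapest pair. The output weighs at most 2w(T) + d', while w(T)
    <= rho w(S), d' <= d and w(S) + d <= OPT. Only the tree term pays the factor 2 rho; rho >= 1 is
    used to enlarge the pendant term as well. The pair is chosen independently of T, so x1 and x2
    may be vertices of T; shortcutting removes them from the interior of the path. No Euler tour is
    formed. The doubled-tree bound is proved by induction along the growth of the tree, for a tour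
    with prescribed first vertex that closes up at the root. Starting at r1, rooting at r2 and
    erasing r2 from the interior gives the two required ends. With at most one terminal no pair
    exists, and a single vertex of weight 0 is the answer. On the machine side the obstacle is
    iteration: a polynomial-time step that doubles its accumulator becomes exponential when folded.
    This dictates how the list functions are written, with flags, a clipped counter and costs that
    are recomputed rather than stored. *)

Definition polyb (p : nat -> nat) := exists k, forall n, p n <= n.+2 ^ k.

Lemma polyb_leq p q : (forall n, p n <= q n) -> polyb q -> polyb p.
Proof. by move=> pq [k qk]; exists k => n; apply: leq_trans (pq n) (qk n). Qed.

(** The base [n.+2] is at least 2 even at 0, so [c < 2 ^ c] absorbs constants into the exponent;
    this is why [polyb] carries no coefficient. *)
Lemma polyb_const c : polyb (fun=> c).
Proof.
exists c => n; apply: leq_trans (ltnW (ltn_expl c (isT : 1 < 2))) _.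
by case: c => [|c] //; rewrite leq_exp2r.
Qed.

Lemma polyb_id : polyb id.
Proof. by exists 1 => n; rewrite expn1; lia. Qed.

Lemma polyb_add p q : polyb p -> polyb q -> polyb (fun n => p n + q n).
Proof.
move=> [k pk] [l ql]; exists (maxn k l).+1 => n.
rewrite expnS mulSn; apply: leq_add.
  by apply: leq_trans (pk n) _; rewrite leq_exp2l // leq_maxl.
apply: leq_trans (leq_pmull _ (ltn0Sn n)).
by apply: leq_trans (ql n) _; rewrite leq_exp2l // leq_maxr.
Qed.

Lemma polyb_mul p q : polyb p -> polyb q -> polyb (fun n => p n * q n).
Proof.
by move=> [k pk] [l ql]; exists (k + l) => n; rewrite expnD leq_mul.
Qed.

Lemma polyb_exp p k : polyb p -> polyb (fun n => p n ^ k).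
Proof.
move=> [l pl]; exists (l * k) => n; rewrite expnM.
by case: k => [|k] //; rewrite leq_exp2r.
Qed.

Ltac polyb :=
  repeat first
    [ apply: polyb_const | apply: polyb_id | apply: polyb_add
    | apply: polyb_mul | apply: polyb_exp | assumption ].

Lemma leq_expW m n k : m <= n -> m ^ k <= n ^ k.
Proof. by move=> mn; case: k => [|k] //; rewrite leq_exp2r. Qed.

(** * Polynomial-time functions on values *)

Lemma bitsize_gt0 v : 0 < bitsize v.
Proof. by case: v. Qed.

Lemma bitsize_hd v : bitsize (val_hd v) <= bitsize v.
Proof. by case: v => [n|a b] //=; lia. Qed.

Lemma bitsize_tl v : bitsize (val_tl v) <= bitsize v.
Proof. by case: v => [n|a b] //=; lia. Qed.

Lemma bitsize_hdtl v : bitsize (val_hd v) + bitsize (val_tl v) <= (bitsize v).+1.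
Proof. by case: v => [n|a b] //=; lia. Qed.

Lemma bitsize_bool (b : bool) : bitsize (Atom b) = 1.
Proof. by case: b. Qed.

Lemma bitsize_num v : bitsize (Atom (val_num v)) <= bitsize v.
Proof. by case: v => [n|a b]. Qed.

Lemma bitsize_leq m n : m <= n -> bitsize (Atom m) <= bitsize (Atom n).
Proof. by move=> mn; rewrite /= ltnS leq_trunc_log. Qed.

Lemma bitsize_atom n m : n < 2 ^ m -> bitsize (Atom n) <= m.+1.
Proof.
case: (posnP n) => [->|n0] nm //.
rewrite /= ltnS -(leq_exp2l _ _ (isT : 1 < 2)).
by apply: leq_trans (trunc_logP _ n0) _; rewrite // ltnW.
Qed.

Lemma ltn_bitsize n : n < 2 ^ bitsize (Atom n).
Proof. exact: trunc_log_ltn. Qed.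

(** Both powers of 2 are at least 2, so their sum is at most their product. The bound is crude, but
    has the same form as for multiplication, which lets [polytime_op] treat all operators alike. *)
Lemma bitsize_add a b :
  bitsize (Atom (val_num a + val_num b)) <= (bitsize a + bitsize b).+1.
Proof.
apply: bitsize_atom; rewrite expnD.
have := ltn_bitsize (val_num a); have := ltn_bitsize (val_num b).
have ha := bitsize_num a; have hb := bitsize_num b.
have := leq_pexp2l (isT : 0 < 2) ha; have := leq_pexp2l (isT : 0 < 2) hb.
have : 2 <= 2 ^ bitsize a by rewrite -{1}(expn1 2) leq_exp2l // bitsize_gt0.
have : 2 <= 2 ^ bitsize b by rewrite -{1}(expn1 2) leq_exp2l // bitsize_gt0.
set A := 2 ^ bitsize a; set B := 2 ^ bitsize b.
nia.
Qed.

Lemma bitsize_mul a b :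
  bitsize (Atom (val_num a * val_num b)) <= (bitsize a + bitsize b).+1.
Proof.
apply: bitsize_atom; rewrite expnD; apply: ltn_mul.
  apply: leq_trans (ltn_bitsize _) _; rewrite leq_exp2l //; exact: bitsize_num.
apply: leq_trans (ltn_bitsize _) _; rewrite leq_exp2l //; exact: bitsize_num.
Qed.

Lemma bitsize_sub a b :
  bitsize (Atom (val_num a - val_num b)) <= bitsize a.
Proof.
apply: leq_trans (bitsize_num a); apply: bitsize_leq; exact: leq_subr.
Qed.

(* The program [C b] finds its argument in variable [b], leaves its result
   there, uses the variables above [b] as scratch space whatever they contain,
   and preserves those below [b]. *)
Definition polytime (f : value -> value) :=
  exists (C : nat -> cmd) (k : nat), forall b s, exists t s',
    [/\ exec (C b) s t s', s' b = f (s b), (forall x, x < b -> s' x = s x)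
      & t + bitsize (f (s b)) <= (bitsize (s b)).+2 ^ k].

Lemma polytimeI f (C : nat -> cmd) p : polyb p ->
  (forall b s, exists t s',
    [/\ exec (C b) s t s', s' b = f (s b), (forall x, x < b -> s' x = s x)
      & t + bitsize (f (s b)) <= p (bitsize (s b))]) -> polytime f.
Proof.
move=> [k pk] H; exists C, k => b s.
have [t [s' [h1 h2 h3 h4]]] := H b s.
by exists t, s'; split=> //; apply: leq_trans h4 (pk _).
Qed.

Lemma polytime_size f : polytime f -> exists k, forall v, bitsize (f v) <= (bitsize v).+2 ^ k.
Proof.
move=> [C [k H]]; exists k => v; have [t [s' [_ _ _]]] := H 0 (fun=> v).
by move=> h; apply: leq_trans h; rewrite leq_addl.
Qed.

Lemma updateE s x v : update s x v x = v.
Proof. by rewrite /update eqxx. Qed.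

Lemma updateN s x v y : y != x -> update s x v y = s y.
Proof. by rewrite /update => /negbTE->. Qed.

Lemma polytime_expr (e : nat -> expr) f c :
  (forall b s, eval s (e b) = f (s b)) ->
  (forall b s, eval_cost s (e b) <= c * bitsize (s b) + c) -> polytime f.
Proof.
move=> ev co; apply: (@polytimeI _ (fun b => Assign b (e b))
  (fun n => (c * n + c + 1) + (c * n + c))); first by polyb.
move=> b s; eexists _, _; split; first exact: exec_assign.
- by rewrite updateE ev.
- by move=> x xb; rewrite updateN // neq_ltn xb.
apply: leq_add; first by rewrite addn1 ltnS co.
rewrite -(ev b s); apply: leq_trans (co b s).
by case: (e b) => *; rewrite /= ?leq_addr.
Qed.

Lemma polytime_comp g f : polytime g -> polytime f -> polytime (fun v => g (f v)).
Proof.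
move=> [Cg [kg Hg]] [Cf [kf Hf]]; apply: (@polytimeI _ (fun b => Seq (Cf b) (Cg b))
  (fun n => (n + 2) ^ kf + ((n + 2) ^ kf + 2) ^ kg + 1)); first by polyb.
move=> b s; have [t [s1 [h1 h2 h3 h4]]] := Hf b s.
have [t' [s2 [g1 g2 g3 g4]]] := Hg b s1.
exists (t + t').+1, s2; split.
- exact: exec_seq h1 g1.
- by rewrite g2 h2.
- by move=> x xb; rewrite g3 // h3.
have h4' : (bitsize (s1 b)).+2 <= (bitsize (s b)).+2 ^ kf + 2 by rewrite h2; lia.
have := leq_expW kg h4'; rewrite h2 in g4 *.
rewrite !addn2; lia.
Qed.

Lemma polytime_id : polytime id.
Proof. by apply: (@polytime_expr Var _ 1) => b s //=; lia. Qed.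

Lemma polytime_const n : polytime (fun=> Atom n).
Proof. by apply: (@polytime_expr (fun=> Const n) _ (trunc_log 2 n).+1) => b s //=; lia. Qed.

Lemma polytime_hd f : polytime f -> polytime (fun v => val_hd (f v)).
Proof.
apply: (@polytime_comp val_hd); apply: (@polytime_expr (fun b => Hd (Var b)) _ 2) => b s //=.
by have := bitsize_hd (s b); lia.
Qed.

Lemma polytime_tl f : polytime f -> polytime (fun v => val_tl (f v)).
Proof.
apply: (@polytime_comp val_tl); apply: (@polytime_expr (fun b => Tl (Var b)) _ 2) => b s //=.
by have := bitsize_tl (s b); lia.
Qed.

Lemma polytime_is_pair f : polytime f -> polytime (fun v => Atom (is_pair (f v))).
Proof.
apply: (@polytime_comp (fun v => Atom (is_pair v))); apply: (@polytime_expr (fun b => IsPair (Var b)) (fun v => Atom (is_pair v)) 2) => b s //=.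
by have := bitsize_bool (is_pair (s b)); rewrite /=; lia.
Qed.

(** The argument must survive the first computation, so each component works on a copy at a fresh
    base: running [Cg] at [b.+1] protects the argument, and running [Cf] at [b.+2] also protects the
    value of [g]. *)
Lemma polytime_pair f g : polytime f -> polytime g -> polytime (fun v => Pair (f v) (g v)).
Proof.
move=> [Cf [kf Hf]] [Cg [kg Hg]].
apply: (@polytimeI (fun v => Pair (f v) (g v)) (fun b => Seq (Assign b.+1 (Var b)) (Seq (Cg b.+1)
    (Seq (Assign b.+2 (Var b)) (Seq (Cf b.+2)
    (Assign b (Defs.Cons (Var b.+2) (Var b.+1)))))))
  (fun n => 2 * n + 4 * (n + 2) ^ kf + 4 * (n + 2) ^ kg + 20)); first by polyb.
move=> b s; set s0 := update s b.+1 (s b).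
have [tg [s1 [g1 g2 g3 g4]]] := Hg b.+1 s0.
set s2 := update s1 b.+2 (s1 b).
have [tf [s3 [f1 f2 f3 f4]]] := Hf b.+2 s2.
have s1b : s1 b = s b by rewrite g3 // /s0 updateN //; lia.
have s3b : s3 b.+1 = g (s b).
  by rewrite f3 // /s2 updateN ?g2 /s0 ?updateE //; lia.
rewrite /s0 updateE in g2 g4; rewrite /s2 updateE s1b in f2 f4.
eexists _, _; split.
- apply: exec_seq (exec_assign _ _ _) _; apply: exec_seq g1 _.
  apply: exec_seq (exec_assign _ _ _) _; apply: exec_seq f1 _.
  exact: exec_assign.
- by rewrite updateE /= f2 s3b.
- move=> x xb; rewrite updateN; last by lia.
  rewrite f3 /s2 ?updateN ?g3 /s0 ?updateN //; lia.
rewrite /= f2 s3b s1b !addn2; lia.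
Qed.

Lemma polytime_op op (o : nat -> nat -> nat) f g :
  (forall s a b, eval s (op a b) =
     Atom (o (val_num (eval s a)) (val_num (eval s b)))) ->
  (forall s a b, eval_cost s (op a b) =
     bitsize (eval s (op a b)) + (eval_cost s a + eval_cost s b)) ->
  (forall a b, bitsize (Atom (o (val_num a) (val_num b))) <=
     (bitsize a + bitsize b).+1) ->
  polytime f -> polytime g -> polytime (fun v => Atom (o (val_num (f v)) (val_num (g v)))).
Proof.
move=> ev co si Pf Pg.
apply: (@polytime_comp (fun p => Atom (o (val_num (val_hd p)) (val_num (val_tl p))))
  (fun v => Pair (f v) (g v))); last exact: polytime_pair.
apply: (@polytime_expr (fun b => op (Hd (Var b)) (Tl (Var b))) _ 6) => b s.
  by rewrite ev.
rewrite co ev /=.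
have := si (val_hd (s b)) (val_tl (s b)).
have := bitsize_hd (s b); have := bitsize_tl (s b).
set X := bitsize _; set Y := bitsize _; set Z := bitsize _; rewrite /=; lia.
Qed.

Definition vadd a b := Atom (val_num a + val_num b).
Definition vsub a b := Atom (val_num a - val_num b).
Definition vmul a b := Atom (val_num a * val_num b).
Definition vleq a b := Atom (val_num a <= val_num b).
Definition veq a b := vmul (vleq a b) (vleq b a).
Definition vif (c a b : value) := if truthy c then a else b.

Lemma polytime_add f g : polytime f -> polytime g -> polytime (fun v => vadd (f v) (g v)).
Proof. by apply: (@polytime_op Add addn) => // a b; apply: bitsize_add. Qed.

Lemma polytime_sub f g : polytime f -> polytime g -> polytime (fun v => vsub (f v) (g v)).
Proof.
apply: (@polytime_op Defs.Sub subn) => // a b.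
by have := bitsize_sub a b; rewrite /=; lia.
Qed.

Lemma polytime_mul f g : polytime f -> polytime g -> polytime (fun v => vmul (f v) (g v)).
Proof. by apply: (@polytime_op Mul muln) => // a b; apply: bitsize_mul. Qed.

Lemma polytime_leq f g : polytime f -> polytime g -> polytime (fun v => vleq (f v) (g v)).
Proof.
apply: (@polytime_op Leq (fun a b => a <= b)) => // a b.
by rewrite bitsize_bool.
Qed.

Lemma polytime_eq f g : polytime f -> polytime g -> polytime (fun v => veq (f v) (g v)).
Proof. by move=> pf pg; apply: polytime_mul; apply: polytime_leq. Qed.

Lemma polytime_if c f g : polytime c -> polytime f -> polytime g -> polytime (fun v => vif (c v) (f v) (g v)).
Proof.
move=> [Cc [kc Hc]] [Cf [kf Hf]] [Cg [kg Hg]].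
apply: (@polytimeI (fun v => vif (c v) (f v) (g v)) (fun b => Seq (Assign b.+1 (Var b)) (Seq (Cc b.+1)
    (If (Var b.+1) (Cf b) (Cg b))))
  (fun n => 4 * n + 4 * (n + 2) ^ kc + (n + 2) ^ kf + (n + 2) ^ kg + 20)); first by polyb.
move=> b s; set s0 := update s b.+1 (s b).
have [tc [s1 [c1 c2 c3 c4]]] := Hc b.+1 s0.
have s1b : s1 b = s b by rewrite c3 // /s0 updateN //; lia.
rewrite /s0 updateE in c2 c4.
have s1l x : x < b -> s1 x = s x.
  by move=> xb; rewrite c3 /s0 ?updateN //; lia.
rewrite /vif; case E: (truthy (c (s b))).
  have [t [s2 [f1 f2 f3 f4]]] := Hf b s1; rewrite s1b in f2 f4.
  eexists _, _; split.
  - apply: exec_seq (exec_assign _ _ _) _; apply: exec_seq c1 _.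
    by apply: exec_if; rewrite /= c2 E; apply: f1.
  - by [].
  - by move=> x xb; rewrite f3 ?s1l.
  by rewrite /= c2 !addn2; lia.
have [t [s2 [f1 f2 f3 f4]]] := Hg b s1; rewrite s1b in f2 f4.
eexists _, _; split.
- apply: exec_seq (exec_assign _ _ _) _; apply: exec_seq c1 _.
  by apply: exec_if; rewrite /= c2 E; apply: f1.
- by [].
- by move=> x xb; rewrite f3 ?s1l.
by rewrite /= c2 !addn2; lia.
Qed.

Fixpoint vfold (h : value -> value) (e a l : value) : value :=
  if l is Pair x l' then vfold h e (h (Pair e (Pair a x))) l' else a.

(* Each step of the fold increases the size of the accumulator by an amount
   that does not depend on the accumulator, which keeps it polynomial. *)
Definition additive_growth (h : value -> value) :=
  exists k, forall e a x, bitsize (h (Pair e (Pair a x))) <=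
    bitsize a + (bitsize e + bitsize x).+2 ^ k.

Lemma bitsize_vfold h : additive_growth h -> exists k, forall e a l,
  bitsize (vfold h e a l) <= bitsize a + bitsize l * (bitsize e + bitsize l).+2 ^ k.
Proof.
move=> [k H]; exists k => e a l.
have: bitsize l <= bitsize l by [].
(* Only the traversed list varies; the [l] under the power stays fixed and bounds every element
   met. *)
move: {1 3 4}l => l'; elim: l' a => [n|x _ l' IH] a ll' /=; first by lia.
rewrite /= in ll'; apply: leq_trans (IH _ _) _; first by lia.
have h1 := H e a x.
have h2 : (bitsize e + bitsize x).+2 <= (bitsize e + bitsize l).+2 by lia.
have h3 := leq_expW k h2; nia.
Qed.

Lemma polytime_fold h e i l : polytime h -> additive_growth h -> polytime e -> polytime i -> polytime l ->
  polytime (fun v => vfold h (e v) (i v) (l v)).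
Proof.
move=> [C [k H]] [q Q] Pe Pi Pl.
pose F v := vfold h (val_hd v) (val_hd (val_tl v)) (val_tl (val_tl v)).
apply: (@polytime_comp F (fun v => Pair (e v) (Pair (i v) (l v)))); last first.
  by do 2![apply: polytime_pair => //].
(* Layout of the loop: [b] holds the environment with the accumulator, [b.+1] the remaining list,
   and [b.+2] is the base at which [h] is run. *)
pose body b := Seq
  (Assign b.+2 (Defs.Cons (Hd (Var b)) (Defs.Cons (Tl (Var b)) (Hd (Var b.+1)))))
  (Seq (C b.+2) (Seq (Assign b (Defs.Cons (Hd (Var b)) (Var b.+2)))
    (Assign b.+1 (Tl (Var b.+1))))).
(* For data of size at most A, [M A] bounds every accumulator met and [B (M A)] the cost of one
   iteration. *)
pose B M := 20 * M + (3 * M + 2) ^ k + 50.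
pose M n := n + n + n * (n + n + 2) ^ q.
(* The last premise is a potential: a step enlarges the accumulator by at most [(A + A + 2) ^ q],
   and consuming a list element releases at least that amount from the second summand. *)
have loop b e0 A : forall l0 s a, s b = Pair e0 a -> s b.+1 = l0 ->
    bitsize e0 <= A -> bitsize l0 <= A ->
    bitsize a + bitsize l0 * (A + A + 2) ^ q <= A + A * (A + A + 2) ^ q ->
    exists t s', [/\ exec (While (IsPair (Var b.+1)) (body b)) s t s',
      s' b = Pair e0 (vfold h e0 a l0), forall x, x < b -> s' x = s x
      & t <= bitsize l0 * B (M A) /\ bitsize (vfold h e0 a l0) <= M A].
  elim=> [n|x _ l0 IH] s a sb sb1 eA lA aA.
    eexists _, _; split; first by apply: exec_while_stop; rewrite /= sb1.
    - by [].
    - by [].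
    split.
      have B50 : 50 <= B (M A) by rewrite leq_addl.
      have -> : eval_cost s (IsPair (Var b.+1)) = 1 + bitsize (Atom n).
        by rewrite /= sb1 addn0.
      by have := leq_mul (leqnn (bitsize (Atom n))) B50; rewrite /=; lia.
    rewrite /= /M; apply: leq_trans (leq_addr _ _) (leq_trans aA _).
    by rewrite leq_add2r leq_addr.
  rewrite /= in lA aA *.
  set s0 := update s b.+2 (Pair e0 (Pair a x)).
  have [t1 [s1 [h1 h2 h3 h4]]] := H b.+2 s0.
  rewrite /s0 updateE in h2 h4.
  have s1b : s1 b = Pair e0 a by rewrite h3 /s0 ?updateN //; lia.
  have s1b1 : s1 b.+1 = Pair x l0 by rewrite h3 /s0 ?updateN //; lia.
  set a' := h _ in h2 h4 *.
  set s2 := update s1 b (Pair e0 a').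
  set s3 := update s2 b.+1 l0.
  have s3b : s3 b = Pair e0 a' by rewrite /s3 updateN /s2 ?updateE //; lia.
  have s3b1 : s3 b.+1 = l0 by rewrite /s3 updateE.
  have q1 := Q e0 a x; rewrite -/a' in q1.
  have q2 : (bitsize e0 + bitsize x).+2 <= A + A + 2 by lia.
  have q3 := leq_expW q q2.
  have [||t2 [s4 [i1 i2 i3 [i4 i5]]]] := IH s3 a' s3b s3b1 eA; first by lia.
    by nia.
  have e1 : exec (body b) s ((eval_cost s (Defs.Cons (Hd (Var b)) (Defs.Cons (Tl (Var b)) (Hd (Var b.+1))))).+1 + (t1 +
     ((eval_cost s1 (Defs.Cons (Hd (Var b)) (Var b.+2))).+1 + (eval_cost s2 (Tl (Var b.+1))).+1).+1).+1).+1 s3.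
    have E1 : s0 = update s b.+2 (eval s (Defs.Cons (Hd (Var b)) (Defs.Cons (Tl (Var b)) (Hd (Var b.+1))))).
      by rewrite /= sb sb1.
    have E2 : s2 = update s1 b (eval s1 (Defs.Cons (Hd (Var b)) (Var b.+2))).
      by rewrite /= s1b h2.
    have E3 : s3 = update s2 b.+1 (eval s2 (Tl (Var b.+1))).
      by rewrite /= /s2 updateN ?s1b1 //; lia.
    rewrite /body; apply: exec_seq (exec_assign _ _ _) _; rewrite -E1.
    apply: exec_seq h1 _; apply: (@exec_seq s1 s2 s3); first by rewrite E2; apply: exec_assign.
    by rewrite E3; apply: exec_assign.
  eexists _, _; split.
  - by apply: exec_while_step e1 i1; rewrite /= sb1.
  - by rewrite i2.
  - by move=> y yb; rewrite i3 // /s3 updateN /s2 ?updateN ?h3 /s0 ?updateN //; lia.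
  split=> //.
  have s2b1 : s2 b.+1 = Pair x l0 by rewrite /s2 updateN //; lia.
  rewrite /= sb sb1 s1b s2b1 h2 /= mulSn mulnDl.
  have aM : bitsize a <= M A.
    rewrite /M; apply: leq_trans (leq_addr _ _) (leq_trans aA _).
    by rewrite leq_add2r leq_addr.
  have a'M : bitsize a' <= M A.
    have := leq_pmull ((A + A + 2) ^ q) (ltn0Sn (bitsize x + bitsize l0)).
    by rewrite /M; lia.
  have AM : A + A <= M A by rewrite /M leq_addr.
  have p1 : (bitsize (Pair e0 (Pair a x))).+2 <= 3 * M A + 2.
    by have := bitsize_gt0 l0; rewrite /=; lia.
  have p2 := leq_expW k p1.
  rewrite {1}/B; rewrite /= in h4 p2 *; have -> : trunc_log 2 1 = 0 by [].
  lia.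
apply: (@polytimeI F (fun b => Seq (Assign b.+1 (Tl (Tl (Var b))))
   (Seq (Assign b (Defs.Cons (Hd (Var b)) (Hd (Tl (Var b)))))
   (Seq (While (IsPair (Var b.+1)) (body b)) (Assign b (Tl (Var b))))))
  (fun n => n * B (M n) + 10 * (M n) + 20 * n + 30)).
  by rewrite /B /M; polyb.
move=> b s; set v := s b.
pose e0 := val_hd v; pose a0 := val_hd (val_tl v); pose l0 := val_tl (val_tl v).
set s0 := update s b.+1 l0; set s1 := update s0 b (Pair e0 a0).
have s1b : s1 b = Pair e0 a0 by rewrite /s1 updateE.
have s1b1 : s1 b.+1 = l0 by rewrite /s1 updateN /s0 ?updateE //; lia.
have ev : bitsize e0 <= bitsize v by apply: bitsize_hd.
have tv : bitsize (val_tl v) <= bitsize v by apply: bitsize_tl.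
have lv : bitsize l0 <= bitsize v by apply: leq_trans (bitsize_tl _) tv.
have av : bitsize a0 <= bitsize v by apply: leq_trans (bitsize_hd _) tv.
have s0b : s0 b = v by rewrite /s0 updateN //; lia.
have [|t [s2 [h1 h2 h3 [h4 h5]]]] := loop b e0 (bitsize v) l0 s1 a0 s1b s1b1 ev lv.
  by apply: leq_add => //; rewrite leq_mul2r lv orbT.
eexists _, _; split.
- apply: (@exec_seq s s0); first exact: exec_assign.
  apply: (@exec_seq s0 s1); last by apply: exec_seq h1 _; apply: exec_assign.
  have -> : s1 = update s0 b (eval s0 (Defs.Cons (Hd (Var b)) (Hd (Tl (Var b))))).
    by rewrite /= s0b.
  exact: exec_assign.
- by rewrite updateE /= h2.
- by move=> x xb; rewrite updateN ?h3 /s1 ?updateN /s0 ?updateN //; lia.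
rewrite /= s0b h2 -/v -/a0 -/l0 -/e0 /= /F -/a0 -/l0 -/e0.
have : bitsize l0 * B (M (bitsize v)) <= bitsize v * B (M (bitsize v)).
  by rewrite leq_mul2r lv orbT.
lia.
Qed.

(** * Running a given program before a polynomial-time function *)

Fixpoint expr_vars (e : expr) : nat :=
  match e with
  | Var x => x.+1
  | Const _ => 0
  | Hd a | Tl a | IsPair a => expr_vars a
  | Defs.Cons a b | Add a b | Defs.Sub a b | Mul a b | Leq a b =>
      maxn (expr_vars a) (expr_vars b)
  end.

Fixpoint cmd_vars (c : cmd) : nat :=
  match c with
  | Skip => 0
  | Assign x e => maxn x.+1 (expr_vars e)
  | Seq c1 c2 => maxn (cmd_vars c1) (cmd_vars c2)
  | If e c1 c2 => maxn (expr_vars e) (maxn (cmd_vars c1) (cmd_vars c2))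
  | While e c => maxn (expr_vars e) (cmd_vars c)
  end.

Lemma eval_frame m s r e : expr_vars e <= m -> (forall x, x < m -> r x = s x) ->
  eval r e = eval s e /\ eval_cost r e = eval_cost s e.
Proof.
move=> em rs; elim: e em => //=.
- by move=> x /rs ->.
- by move=> a IHa b IHb; rewrite geq_max => /andP[/IHa[-> ->] /IHb[-> ->]].
- by move=> a IH /IH[-> ->].
- by move=> a IH /IH[-> ->].
- by move=> a IH /IH[-> ->].
- by move=> a IHa b IHb; rewrite geq_max => /andP[/IHa[-> ->] /IHb[-> ->]].
- by move=> a IHa b IHb; rewrite geq_max => /andP[/IHa[-> ->] /IHb[-> ->]].
- by move=> a IHa b IHb; rewrite geq_max => /andP[/IHa[-> ->] /IHb[-> ->]].
- by move=> a IHa b IHb; rewrite geq_max => /andP[/IHa[-> ->] /IHb[-> ->]].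
Qed.

(** A program reads and writes only the variables below [cmd_vars], so its run can be replayed, in
    the same time, in a store that hides other data above them. *)
Lemma exec_frame m c s t s' : exec c s t s' -> cmd_vars c <= m ->
  forall r, (forall x, x < m -> r x = s x) ->
  exists r', [/\ exec c r t r', forall x, x < m -> r' x = s' x
    & forall x, m <= x -> r' x = r x].
Proof.
elim=> {c s t s'} /=.
- by move=> s _ r rs; exists r; split=> //; apply: exec_skip.
- move=> s x e; rewrite geq_max => /andP[xm em] r rs.
  have [<- <-] := eval_frame em rs.
  exists (update r x (eval r e)); split; first exact: exec_assign.
    by move=> y ym; rewrite /update; case: eqP => // _; apply: rs.
  by move=> y ym; rewrite updateN //; lia.
- move=> s s1 s2 t1 t2 c1 c2 _ IH1 _ IH2; rewrite geq_max => /andP[m1 m2] r rs.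
  have [r1 [e1 a1 b1]] := IH1 m1 r rs; have [r2 [e2 a2 b2]] := IH2 m2 r1 a1.
  exists r2; split=> //; first exact: exec_seq e1 e2.
  by move=> x xm; rewrite b2 // b1.
- move=> s s1 t e c1 c2 _ IH; rewrite !geq_max => /and3P[em m1 m2] r rs.
  have [ev ec] := eval_frame em rs; rewrite -ec.
  have [|r1 [e1 a1 b1]] := IH _ r rs; first by case: ifP.
  by exists r1; split=> //; apply: exec_if; rewrite ev.
- move=> s e c ne; rewrite geq_max => /andP[em m1] r rs.
  have [ev ec] := eval_frame em rs; rewrite -ec.
  by exists r; split=> //; apply: exec_while_stop; rewrite ev.
move=> s s1 s2 t1 t2 e c te _ IH1 _ IH2; rewrite geq_max => /andP[em m1] r rs.
have [ev ec] := eval_frame em rs; rewrite -ec.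
have [r1 [e1 a1 b1]] := IH1 m1 r rs.
have [|r2 [e2 a2 b2]] := IH2 _ r1 a1; first by rewrite /= geq_max em.
exists r2; split=> //; last by move=> x xm; rewrite b2 // b1.
by apply: exec_while_step e1 e2; rewrite ev.
Qed.

Lemma eval_leq_cost s e : bitsize (eval s e) <= eval_cost s e.
Proof. by case: e => *; rewrite /= ?leq_addr. Qed.

(** Building a value costs at least its size. The output of the given Steiner tree program is
    therefore of polynomial size. *)
Lemma exec_bitsize c s t s' x : exec c s t s' -> bitsize (s' x) <= bitsize (s x) + t.
Proof.
elim=> {c s t s'} //=; try (by move=> *; lia).
move=> s y e; rewrite /update; case: eqP => _; last by lia.
by have := eval_leq_cost s e; lia.
Qed.

(** The second phase needs the instance, which [P] may overwrite; it is saved in a variable [m] that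
    [P] never touches. The successor in [m] keeps it different from 0, where [P] leaves its output,
    even if [cmd_vars P] is 0. *)
Lemma runs_then P f : polytime f -> exists Q k, forall i t v, runs P i t v ->
  exists2 t', runs Q i t' (f (Pair i v)) & t' <= (t + bitsize i).+2 ^ k.
Proof.
move=> [C [k H]]; pose m := (cmd_vars P).+1.
exists (Seq (Assign m (Var 0)) (Seq P (Seq (Assign m (Defs.Cons (Var m) (Var 0)))
  (Seq (C m) (Assign 0 (Var m)))))).
suff [K HK] : polyb (fun n => 10 * n + 10 * (2 * n + 10) ^ k + 20).
  exists K => i t v [s es <-].
  set s0 := fun x => _ in es.
  have rs0 x : x < m -> update s0 m i x = s0 x.
    by move=> xm; rewrite updateN //; lia.
  have [r1 [e1 a1 b1]] := exec_frame es (leqnSn _) rs0.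
  have r1m : r1 m = i by rewrite b1 // updateE.
  have r10 : r1 0 = s 0 by rewrite a1.
  set r2 := update r1 m (Pair i (s 0)).
  have E2 : r2 = update r1 m (eval r1 (Defs.Cons (Var m) (Var 0))).
    by rewrite /= r1m r10.
  have [t2 [r3 [e3 a3 b3 c3]]] := H m r2.
  rewrite /r2 updateE in a3 c3.
  have sz := exec_bitsize 0 es.
  exists ((eval_cost s0 (Var 0)).+1 + (t + ((eval_cost r1 (Defs.Cons (Var m) (Var 0))).+1 +
      (t2 + (eval_cost r3 (Var m)).+1).+1).+1).+1).+1.
    exists (update r3 0 (f (Pair i (s 0)))); last by rewrite updateE.
    apply: (@exec_seq s0 (update s0 m i)); first exact: exec_assign.
    apply: exec_seq e1 _; apply: (@exec_seq r1 r2); first by rewrite E2; apply: exec_assign.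
    apply: exec_seq e3 _; rewrite -a3; exact: exec_assign.
  apply: leq_trans (HK _); rewrite /= r1m r10 a3.
  have h : (bitsize (Pair i (s 0))).+2 <= 2 * (t + bitsize i) + 10.
    by rewrite /=; rewrite /s0 /= in sz; lia.
  have := leq_expW k h; rewrite /s0 /= in sz c3 *; lia.
by polyb.
Qed.

(** * Trees *)

Lemma set2_eq (V : finType) (a b c d : V) :
  [set a; b] = [set c; d] -> a = c /\ b = d \/ a = d /\ b = c.
Proof.
move=> E; have := set21 a b; have := set22 a b; have := set22 c d; have := set21 c d.
rewrite E -{1 2}E !inE.
by do 4![case/orP=> /eqP ?]; subst; auto.
Qed.

Lemma adj_sym (V : finType) (T : subgraph V) : symmetric (adj T).
Proof. by move=> x y; rewrite /adj setUC. Qed.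

Section Trees.
Variables (V : finType) (T : subgraph V).
Hypotheses (sT : is_subgraph T) (cT : connected T) (aT : acyclic T).

Lemma adj_neq x y : adj T x y -> x != y.
Proof. by move/sT => []; rewrite cards2; case: eqP. Qed.

Lemma adj_verts x y : adj T x y -> x \in verts T.
Proof. by move/sT => [_ /subsetP]; apply; rewrite !inE eqxx. Qed.

Lemma edgeP e x : e \in edges T -> x \in e -> exists2 y, adj T x y & e = [set x; y].
Proof.
move=> eT xe; have [/eqP/cards2P[a [b [ab E]]] _] := sT eT.
move: xe; rewrite E !inE => /orP[]/eqP ->; first by exists b; rewrite // /adj -E.
by exists a; rewrite 1?setUC // /adj setUC -E.
Qed.

Lemma leaf_neighbor_uniq x a b : leaf T x -> adj T a x -> adj T b x -> a = b.
Proof.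
move=> [_ /eqP/cards1P[e E]] ax bx.
have : [set a; x] \in [set e in edges T | x \in e] by rewrite inE -/(adj T a x) ax set22.
have : [set b; x] \in [set e in edges T | x \in e] by rewrite inE -/(adj T b x) bx set22.
by rewrite E !inE => /eqP <- /eqP/set2_eq[[]|[-> ->]].
Qed.

Lemma leaf_intro x a : adj T a x -> (forall b, adj T b x -> b = a) -> leaf T x.
Proof.
move=> ax U; split; first by apply: (@adj_verts x a); rewrite adj_sym.
apply/eqP/cards1P; exists [set a; x]; apply/setP => e; rewrite !inE.
apply/andP/eqP => [[eT xe]|->]; last by rewrite !inE eqxx orbT.
have [y xy ->] := edgeP eT xe; rewrite adj_sym in xy.
by rewrite setUC (U _ xy).
Qed.

Lemma path_verts x p : x \in verts T -> path (adj T) x p -> {subset x :: p <= verts T}.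
Proof.
elim: p x => [|y p IH] x xV /=; first by move=> _ t; rewrite inE => /eqP ->.
move=> /andP[xy yp] t; rewrite inE => /orP[/eqP ->//|]; apply: IH => //.
by apply: (@adj_verts y x); rewrite adj_sym.
Qed.

(** With two or more edges the closed path would be a cycle of length at least 3. A single edge
    remains possible, since going back and forth is a [ucycle]. *)
Lemma closing_path x p : path (adj T) x p -> uniq (x :: p) -> adj T (last x p) x ->
  size p <= 1.
Proof.
move=> xp up lx; have /aT : ucycle (adj T) (x :: p).
  by rewrite /ucycle up /= rcons_path xp lx.
by [].
Qed.

(** A longest simple path from [s] ends in a leaf: by maximality every neighbour of its end lies on
    the path, and acyclicity leaves only the predecessor. Taking [s] to be a leaf yields a second
    one. *)
Lemma leaf_exists s : s \in verts T -> 1 < #|verts T| -> exists2 x, leaf T x & x != s.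
Proof.
move=> sV V2.
pose P k := `[< exists p, [/\ path (adj T) s p, uniq (s :: p) & size p = k] >].
have exP : exists k, P k by exists 0; apply/asboolP; exists [::].
have bP k : P k -> k <= #|V|.
  move=> /asboolP[p [_ up <-]]; apply: ltnW.
  by have := card_uniqP up => /= <-; apply: max_card.
case: (ex_maxnP exP bP) => k /asboolP[p [sp up <-]] {k} maxp.
have {}maxp q : path (adj T) s q -> uniq (s :: q) -> size q <= size p.
  by move=> sq uq; apply: maxp; apply/asboolP; exists q.
case/lastP: p sp up maxp => [|p x] sp up maxp.
  have [t tV ts] : exists2 t, t \in verts T & t != s.
    apply/exists_inP; apply: contraLR V2; rewrite -leqNgt => /exists_inPn H.
    rewrite -(cards1 s) subset_leq_card //; apply/subsetP => t /H.
    by rewrite negbK inE.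
  have /connectP[[|y q] /=] := cT.2 _ _ sV tV; first by move=> _ E; rewrite E eqxx in ts.
  move=> /andP[sy _] _; have := maxp [:: y]; rewrite /= sy inE (adj_neq sy).
  by move=> /(_ isT isT).
have xs : x != s.
  by apply: contraTneq up => ->; rewrite /= mem_rcons inE eqxx.
exists x => //; move: (sp); rewrite rcons_path => /andP[sp' yx].
apply: leaf_intro yx _ => z zx.
have zp : z \in s :: rcons p x.
  apply: contraT => zp; have := maxp (rcons (rcons p x) z).
  rewrite rcons_path sp last_rcons adj_sym zx -rcons_cons rcons_uniq zp up size_rcons.
  by move=> /(_ isT isT); rewrite ltnn.
have zNx := adj_neq zx.
(* The neighbour [z] cuts the path; the piece from [z] to [x] is closed by the edge joining them, so
   it is a single edge and [z] precedes [x]. *)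
case/splitPl E: {1}(rcons p x) / zp => [p1 p2 lz].
have l2 : last z p2 = x by have := congr1 (last s) E; rewrite last_rcons last_cat lz.
have : size p2 <= 1.
  apply: (@closing_path z).
  - by move: sp; rewrite E cat_path lz => /andP[].
  - move: up; rewrite E -cat_cons cat_uniq => /and3P[_ h u2] /=; rewrite u2 andbT.
    by apply: contra h => h; apply/hasP; exists z => //; rewrite -lz mem_last.
  by rewrite l2 adj_sym.
case: p2 l2 E => [|x' [|]] //=; first by move=> zx'; rewrite zx' eqxx in zNx.
by move=> -> E _; move: E; rewrite cats1 => /rcons_inj[->].
Qed.

Definition del_vertex x : subgraph V :=
  Subgraph (verts T :\ x) [set e in edges T | x \notin e].

Lemma del_leaf_subgraph x : is_subgraph (del_vertex x).
Proof.
move=> e; rewrite inE => /andP[/sT[e2 eV] xe]; split=> //.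
by rewrite subsetD1 eV.
Qed.

Lemma del_leaf_acyclic x : acyclic (del_vertex x).
Proof.
move=> c /andP[cc uc]; apply: aT; rewrite /ucycle uc andbT.
by apply: sub_cycle cc => a b; rewrite /adj inE => /andP[].
Qed.

(** A simple path between other vertices avoids the leaf: its predecessor and successor on the path
    would both be the unique neighbour, hence equal. *)
Lemma del_leaf_connected x : leaf T x -> 1 < #|verts T| -> connected (del_vertex x).
Proof.
move=> lx V2; split.
  by rewrite -card_gt0; move: V2; rewrite (cardsD1 x) lx.1.
move=> y z /=; rewrite !inE => /andP[yx yV] /andP[zx zV].
have /connectP[q yq E] := cT.2 _ _ yV zV.
rewrite {z zV}E in zx *; case/shortenP: yq zx => p yp up _ lp.
have xp : x \notin p.
  apply: contra lp => /splitPr E; case: E yp up => p1 [|t p2] yp up.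
    by rewrite last_cat.
  move: yp; rewrite cat_path /= => /and4P[_ px xt _].
  have : uniq ((y :: p1) ++ [:: x, t & p2]) by [].
  rewrite cat_uniq => /and3P[_ /hasPn/(_ t)]; rewrite !inE eqxx orbT => /(_ isT).
  by rewrite -(leaf_neighbor_uniq lx px (_ : adj T t x)) 1?adj_sym // -in_cons mem_last.
apply/connectP; exists p => //.
apply: (sub_in_path (P := predC1 x)) yp.
  move=> a b; rewrite !inE => ax bx ab.
  by rewrite /adj inE -/(adj T a b) ab !inE negb_or !(eq_sym x) ax bx.
rewrite /= yx; apply/allP => t tp; rewrite !inE.
by apply: contraNneq xp => <-.
Qed.

End Trees.

Lemma edge_size (V : finType) (T : subgraph V) : is_subgraph T ->
  forall e, e \in edges T -> exists x y, x != y /\ e = [set x; y].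
Proof. by move=> sT e /sT[/eqP/cards2P]. Qed.

Lemma leaf_verts (V : finType) (T : subgraph V) x :
  is_subgraph T -> leaf T x -> 1 < #|verts T|.
Proof.
move=> sT [xV /eqP/cards1P[e E]].
have : e \in [set e in edges T | x \in e] by rewrite E set11.
by rewrite inE => /andP[/sT[<- eV] _]; apply: subset_leq_card.
Qed.

Lemma steiner_core (V : finType) (R : {set V}) (T : subgraph V) : steiner_tree R T ->
  exists S, [/\ steiner_tree R S, verts S \subset verts T, edges S \subset edges T
    & forall x, leaf S x -> x \in R].
Proof.
have [n] := ubnP #|verts T|; elim: n T => // n IH T nT stT.
have [sT cT aT RT] := stT.
have [[x [lx xR]]|H] := pselect (exists x, leaf T x /\ x \notin R); last first.
  exists T; split=> // x lx; apply: contrapT => xR; apply: H; exists x; split=> //.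
  exact/negP.
have V2 := leaf_verts sT lx.
have [||S [h1 h2 h3 h4]] := IH (del_vertex T x).
- by move: nT; rewrite (cardsD1 x) lx.1.
- split; [exact: del_leaf_subgraph|exact: del_leaf_connected|exact: del_leaf_acyclic|].
  by rewrite subsetD1 RT.
exists S; split=> //; first by apply: subset_trans h2 (subsetDl _ _).
by apply: subset_trans h3 _; apply/subsetP => e; rewrite inE => /andP[].
Qed.

(** * Weights: the lower bound for feasible trees, and lengths of vertex sequences *)

Section Weights.
Variables (V : finType) (w : {set V} -> rat) (wM : metric w).
Local Open Scope ring_scope.

Lemma weight_sub (A B : {set {set V}}) : A \subset B ->
  (forall e, e \in B -> exists x y, x != y /\ e = [set x; y]) ->
  \sum_(e in A) w e <= \sum_(e in B) w e.
Proof.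
move=> AB B2; rewrite (big_setID A (A := B)) /= (setIidPr AB) lerDl.
apply: sumr_ge0 => e; rewrite inE => /andP[_ /B2[x [y [xy ->]]]]; exact: wM.1.
Qed.

Lemma weight_ge0 (T : subgraph V) : is_subgraph T -> 0 <= weight w T.
Proof.
move=> sT; apply: sumr_ge0 => e /(edge_size sT)[x [y [xy ->]]]; exact: wM.1.
Qed.

(* In the core [S] of [T], the leaves are terminals, hence each of them has a
   further neighbour in [T], outside [S]. *)
Lemma internal_lower_bound (R : {set V}) (T : subgraph V) :
  steiner_tree R T -> {in R, forall x, ~ leaf T x} -> (1 < #|R|)%N ->
  exists S r1 r2 x1 x2, [/\ steiner_tree R S,
    [/\ r1 \in R, r2 \in R & r1 != r2], [/\ x1 \notin R, x2 \notin R & x1 != x2]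
    & weight w S + (w [set r1; x1] + w [set r2; x2]) <= weight w T].
Proof.
move=> stT nl R2; have [S [stS SV SE Sl]] := steiner_core stT.
have [sT cT aT RT] := stT; have [sS cS aS RS] := stS.
have S2 : (1 < #|verts S|)%N by apply: leq_trans R2 (subset_leq_card RS).
have [/set0Pn[s sV] _] := cS.
have [r1 l1 _] := leaf_exists sS cS aS sV S2.
have [r2 l2 r21] := leaf_exists sS cS aS l1.1 S2.
have adjST a b : adj S a b -> adj T a b by apply: (subsetP SE).
(* An edge of [T] between vertices of [S] but not in [S] would close a cycle with the path of [S]
   joining them. *)
have chord a b : a \in verts S -> b \in verts S -> adj T a b -> adj S a b.
  move=> aV bV ab; have /connectP[q aq E] := cS.2 _ _ aV bV.
  rewrite {b bV}E in ab *; case/shortenP: aq ab => p ap up _ ab.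
  have := closing_path aT (sub_path adjST ap) up; rewrite adj_sym => /(_ ab).
  case: p ap up ab => [|y [|]] //=; last by rewrite andbT.
  by move=> _ _ /(adj_neq sT); rewrite eqxx.
(* If all neighbours of [r] in [T] lay in [S], [chord] would make them neighbours in [S], and [r]
   would be a leaf of [T] too. *)
have out r : leaf S r -> exists x, adj T r x /\ x \notin verts S.
  move=> lr; apply: contrapT => H; apply: (nl r); first exact: Sl.
  have [y ry] : exists y, adj S r y.
    have [_ /eqP/cards1P[e E]] := lr.
    have : e \in [set e in edges S | r \in e] by rewrite E set11.
    by rewrite inE => /andP[eS re]; have [y ry _] := edgeP sS eS re; exists y.
  apply: (leaf_intro sT (a := y)); first by rewrite adj_sym; apply: adjST.
  move=> b br; apply: (leaf_neighbor_uniq lr); last by rewrite adj_sym.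
  apply: chord => //; last exact: lr.1.
  by apply: contrapT => /negP bS; apply: H; exists b; rewrite adj_sym.
have [x1 [rx1 xS1]] := out _ l1; have [x2 [rx2 xS2]] := out _ l2.
exists S, r1, r2, x1, x2; split=> //.
- by split; rewrite ?Sl // eq_sym.
- split; [by apply: contra xS1 => /(subsetP RS) |by apply: contra xS2 => /(subsetP RS)|].
  apply: contraNneq r21 => E; rewrite -E in rx2.
  have /connectP[q aq E2] := cS.2 _ _ l1.1 l2.1.
  rewrite {}E2 in rx2 *; case/shortenP: aq rx2 => p ap up sp rx2.
  have up1 : uniq (x1 :: r1 :: p).
    by rewrite cons_uniq up andbT; apply: contra xS1; apply: (path_verts sS l1.1 ap).
  have xp : path (adj T) x1 (r1 :: p) by rewrite /= adj_sym rx1 (sub_path adjST).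
  by have := closing_path aT xp up1 rx2; case: p {ap up sp rx2 up1 xp}.
have E2S : [set r2; x2] \notin edges S.
  by apply: contra xS2 => /sS[_ /subsetP]; apply; rewrite set22.
(* The two pendant edges differ because [r1] is neither [r2] nor [x2], the latter being outside
   [S]. *)
have E1S : [set r1; x1] \notin [set r2; x2] |: edges S.
  rewrite !inE negb_or; apply/andP; split; last first.
    by apply: contra xS1 => /sS[_ /subsetP]; apply; rewrite set22.
  apply: contra xS2 => /eqP/set2_eq[[E _]|[<- _]]; first by rewrite E eqxx in r21.
  exact: l1.1.
have := weight_sub (A := [set r1; x1] |: ([set r2; x2] |: edges S)) _ (edge_size sT).
rewrite big_setU1 //= big_setU1 //= addrA addrC; apply.
apply/subsetP => e; rewrite !inE => /or3P[/eqP ->|/eqP ->|/(subsetP SE)] //.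
Qed.

(** The zero diagonal makes the triangle inequality hold without distinctness conditions, and is the
    convention of the weight matrix in [enc_instance]. *)
Definition dist x y := if x == y then 0 else w [set x; y].

Lemma dist_ge0 x y : 0 <= dist x y.
Proof. by rewrite /dist; case: eqP => // /eqP; apply: wM.1. Qed.

Lemma distxx x : dist x x = 0.
Proof. by rewrite /dist eqxx. Qed.

Lemma dist_sym x y : dist x y = dist y x.
Proof. by rewrite /dist eq_sym setUC. Qed.

Lemma dist_triangle y x z : dist x z <= dist x y + dist y z.
Proof.
have [->|xz] := eqVneq x z; first by rewrite distxx addr_ge0 ?dist_ge0.
have [<-|xy] := eqVneq x y; first by rewrite distxx add0r.
have [->|yz] := eqVneq y z; first by rewrite distxx addr0.
by rewrite /dist (negbTE xz) (negbTE xy) (negbTE yz); apply: wM.2.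
Qed.

Fixpoint plen x s : rat := if s is y :: s' then dist x y + plen y s' else 0.

Lemma plen_cat x s y t : plen x (s ++ y :: t) = plen x (rcons s y) + plen y t.
Proof. by elim: s x => [|z s IH] x /=; rewrite ?addr0 // IH addrA. Qed.

Lemma plen_triangle x y s : plen x s <= dist x y + plen y s.
Proof.
case: s => [|z s] /=; first by rewrite addr0 dist_ge0.
by rewrite addrA lerD2r dist_triangle.
Qed.

(** This is shortcutting: skipping a vertex costs nothing by the triangle inequality. Both ends are
    kept out of the filter. *)
Lemma plen_filter P x s y : plen x (rcons (filter P s) y) <= plen x (rcons s y).
Proof.
elim: s x => [|z s IH] x //=; case: (P z) => /=; first by rewrite lerD2l IH.
by apply: le_trans (IH x) (plen_triangle _ _ _).
Qed.

Lemma plen_rev x s y : plen x (rcons s y) = plen y (rcons (rev s) x).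
Proof.
elim: s x => [|z s IH] x /=; first by rewrite !addr0 dist_sym.
rewrite IH rev_cons -[in RHS]cats1 cat_rcons plen_cat /= addr0 addrC.
by rewrite [dist z x]dist_sym.
Qed.

End Weights.

(** * Hamiltonian paths from trees *)

Section Paths.
Variable V : finType.
Implicit Types s p q : seq V.

Definition steps s := zip s (behead s).

Definition edge_set (es : seq (V * V)) : {set {set V}} :=
  [set:: [seq [set e.1; e.2] | e <- es]].

Definition path_graph s := Subgraph [set x in s] (edge_set (steps s)).

Lemma edge_setP es a b :
  reflect ((a, b) \in es \/ (b, a) \in es) ([set a; b] \in edge_set es).
Proof.
rewrite inE; apply: (iffP mapP) => [[[c d] ce /= /set2_eq[][-> ->]]|[] h]; auto.
  by exists (a, b).
by exists (b, a); rewrite // setUC.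
Qed.

Lemma steps_cons x y s : steps [:: x, y & s] = (x, y) :: steps (y :: s).
Proof. by []. Qed.

Lemma index_consN z s x : z \notin s -> x \in s -> index x (z :: s) = (index x s).+1.
Proof. by move=> zs xs; rewrite /= ifN //; apply: contraNneq zs => ->. Qed.

Lemma steps_index s x y : uniq s -> (x, y) \in steps s ->
  [/\ x \in s, y \in s & index y s = (index x s).+1].
Proof.
elim: s => // z [|t s] IH // /andP[zs us]; rewrite steps_cons inE => /orP[].
  move=> /eqP[-> ->]; rewrite !inE !eqxx !orbT.
  by rewrite (index_consN zs) ?inE ?eqxx //= !eqxx.
move=> /(IH us)[xs ys E]; split; rewrite 1?inE ?xs ?ys ?orbT //.
by rewrite !(index_consN zs) // E.
Qed.

Lemma path_graph_adj s a b : uniq s -> adj (path_graph s) a b ->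
  [/\ a \in s, b \in s & index b s = (index a s).+1 \/ index a s = (index b s).+1].
Proof. by move=> us /edge_setP[] /(steps_index us)[]; split=> //; auto. Qed.

Lemma path_graph_subgraph s : uniq s -> is_subgraph (path_graph s).
Proof.
move=> us e; rewrite inE => /mapP[[x y] /(steps_index us)[xs ys E] ->] /=.
rewrite cards2; case: eqP => [xy|_]; first by move: E; rewrite xy; lia.
by split=> //; apply/subsetP => z; rewrite !inE => /orP[]/eqP ->.
Qed.

(** On a cycle, take the vertex of largest index in [s]. Both its neighbours have the index just
    below, so they coincide and the cycle has length at most 2. *)
Lemma path_graph_acyclic s : uniq s -> acyclic (path_graph s).
Proof.
move=> us c /andP[cc uc]; case: c cc uc => // x0 c0 cc uc.
have [x xc maxx] : exists2 x, x \in x0 :: c0 &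
    forall y, y \in x0 :: c0 -> index y s <= index x s.
  have x0c : x0 \in x0 :: c0 by rewrite inE eqxx.
  by case: (arg_maxnP (index^~ s) x0c) => x xc mx; exists x.
have [i c' E] := rot_to xc.
rewrite -(size_rot i) E; rewrite -(rot_uniq i) E in uc.
rewrite -(rot_cycle i) E in cc.
have {}maxx y : y \in x :: c' -> index y s <= index x s.
  by rewrite -E mem_rot; apply: maxx.
case/lastP: c' {E} cc uc maxx => [|c' z] //; case: c' => [|y c'] // cc uc maxx.
have xy : adj (path_graph s) x y by move: cc => /= /andP[].
have zx : adj (path_graph s) z x by move: cc; rewrite /= !rcons_path last_rcons => /and3P[].
have my : y \in x :: rcons (y :: c') z by rewrite !inE eqxx orbT.
have mz : z \in x :: rcons (y :: c') z by rewrite inE mem_rcons inE eqxx orbT.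
have [xs ys [Ey|Ey]] := path_graph_adj us xy.
  by have := maxx y my; rewrite Ey ltnn.
have [zs _ [Ez|Ez]] := path_graph_adj us zx; last first.
  by have := maxx z mz; rewrite Ez ltnn.
have zy : z = y.
  by rewrite -(nth_index x zs) -(nth_index x ys); congr nth; apply/eq_add_S; rewrite -Ey -Ez.
by move: uc; rewrite zy /= mem_rcons inE eqxx /= andbF.
Qed.

Lemma path_graph_connected s : s != [::] -> connected (path_graph s).
Proof.
case: s => // x s _; split; first by apply/set0Pn; exists x; rewrite !inE eqxx.
have conn : path (adj (path_graph (x :: s))) x s.
  (* The edge set is generalised because the induction shortens the list while the edges remain
     those of the whole path. *)
  suff: forall es, {subset steps (x :: s) <= es} ->
      path (fun a b => [set a; b] \in edge_set es) x s by apply.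
  elim: s x => //= y s IH x es sub; apply/andP; split.
    by apply/edge_setP; left; apply: sub; rewrite inE eqxx.
  by apply: IH => e es'; apply: sub; rewrite inE es' orbT.
have all_conn y : y \in x :: s -> connect (adj (path_graph (x :: s))) x y.
  exact: (path_connect conn).
have sy : connect_sym (adj (path_graph (x :: s))).
  by apply: sym_connect_sym; apply: adj_sym.
move=> y z; rewrite !inE -!in_cons => ys zs.
by apply: connect_trans (all_conn _ zs); rewrite sy all_conn.
Qed.

Lemma mem_steps p a b q : (a, b) \in steps (p ++ [:: a, b & q]).
Proof.
elim: p => [|x p IH]; first by rewrite steps_cons inE eqxx.
by case: p IH => [|y p] IH; rewrite /= steps_cons inE IH orbT.
Qed.

Lemma path_graph_interior s a b x p q : uniq s ->
  s = p ++ [:: a, x, b & q] -> ~ leaf (path_graph s) x.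
Proof.
move=> us E lx; have ab : a = b.
  apply: (leaf_neighbor_uniq lx); apply/edge_setP.
    by left; rewrite E mem_steps.
  by right; rewrite E -cat_rcons mem_steps.
by move: us; rewrite E ab cat_uniq /= !inE eqxx !orbT !andbF.
Qed.

Lemma path_graph_weight (w : {set V} -> rat) x s : metric w -> uniq (x :: s) ->
  (weight w (path_graph (x :: s)) <= plen w x s)%R.
Proof.
move=> wM; rewrite /weight [edges _]/=.
elim: s x => [|y s IH] x us.
  by rewrite /edge_set /= set_nil big_set0.
have /andP[xys uys] := us; rewrite steps_cons /= /dist ifN; last first.
  by apply: contraNneq xys => ->; rewrite inE eqxx.
apply: le_trans (_ : w [set x; y] + \sum_(e in edge_set (steps (y :: s))) w e <= _)%R; last first.
  by rewrite lerD2l IH.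
rewrite /edge_set /= set_cons.
(* That the edge is new need not be proved: had it occurred already, the sum would not change and a
   nonnegative term is merely added on the right. *)
set E := [set:: _]; have [xyE|xyE] := boolP ([set x; y] \in E); last by rewrite big_setU1.
rewrite (setUidPr _) ?sub1set // lerDr; apply: wM.1.
by apply: contraNneq xys => ->; rewrite inE eqxx.
Qed.

End Paths.

(** * Growing a rooted tree from a list of edges, and touring it *)

Section Growth.
Variable V : finType.
Implicit Types (g : seq (V * V)) (s : seq V).

Fixpoint insert_after (v u : V) s : seq V :=
  if s is x :: s' then if x == u then [:: x, v & s'] else x :: insert_after v u s'
  else [::].

Lemma insert_after_perm v u s : u \in s -> perm_eq (insert_after v u s) (v :: s).
Proof.
elim: s => //= x s IH; rewrite inE eq_sym; case: eqP => [_ _|_ /= us].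
  by rewrite (perm_catCA [:: x] [:: v] s).
rewrite perm_sym (perm_catCA [:: v] [:: x] s) /= perm_cons perm_sym.
exact: IH.
Qed.

Lemma insert_after_head v u x s : exists s', insert_after v u (x :: s) = x :: s'.
Proof. by rewrite /=; case: eqP => _; eexists. Qed.

(** The detour goes from [u] to [v] and, by the triangle inequality, at worst back through [u] to
    the next vertex. *)
Lemma plen_insert_after (w : {set V} -> rat) v u x s y : metric w -> u \in s ->
  (plen w x (rcons (insert_after v u s) y) <= plen w x (rcons s y) + 2 * dist w v u)%R.
Proof.
move=> wM; elim: s x => //= z s IH x; rewrite inE eq_sym.
case: eqP => [-> _|_ /= us] /=; last by rewrite -addrA lerD2l IH.
have := plen_triangle wM v u (rcons s y); rewrite (dist_sym w u v).
by move: (plen _ _ _) (plen _ _ _) => a b; lra.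
Qed.

(* A rooted tree as the list of its pairs (vertex, parent), the vertices added
   last coming first; the root is its own parent. *)
Inductive grown (T : subgraph V) (r : V) : seq (V * V) -> Prop :=
| grown_root : grown T r [:: (r, r)]
| grown_step v u g : grown T r g -> v \notin unzip1 g -> u \in unzip1 g ->
    adj T v u -> grown T r ((v, u) :: g).

Lemma grown_uniq T r g : grown T r g -> uniq (unzip1 g).
Proof. by elim=> //= v u g' _ -> ->. Qed.

(** Each new parent edge contains a vertex absent from the older list, so it is not among the edges
    of [T] spanned by that list; the root pair contributes 0. *)
Lemma grown_weight (w : {set V} -> rat) T r g : metric w -> is_subgraph T ->
  grown T r g -> (\sum_(p <- g) dist w p.1 p.2 <= weight w T)%R.
Proof.
move=> wM sT gg; pose E g := [set e in edges T | e \subset unzip1 g].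
apply: le_trans (_ : \sum_(e in E g) w e <= _)%R; last first.
  apply: (weight_sub wM); last exact: edge_size.
  by apply/subsetP => e; rewrite inE => /andP[].
elim: gg => [|v u g' gg IH vg ug vu].
  rewrite big_seq1 distxx; apply: sumr_ge0 => e; rewrite inE => /andP[eT _].
  by have [x [y [xy ->]]] := edge_size sT eT; apply: wM.1.
rewrite big_cons /= /dist ifN; last by apply: contraNneq vg => ->.
have vuE : [set v; u] \notin E g'.
  rewrite inE negb_and; apply/orP; right; apply: contra vg => /subsetP; apply.
  exact: set21.
apply: (@le_trans _ _ (\sum_(e in [set v; u] |: E g') w e)%R).
  by rewrite big_setU1 //= lerD2l.
apply: (weight_sub wM) => [|e]; last by rewrite inE => /andP[/(edge_size sT)].
apply/subsetP => e; rewrite !inE => /predU1P[->|/andP[-> eg]] /=.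
  rewrite -/(adj T v u) vu; apply/subsetP => x /set2P[] -> /=.
    exact: mem_head.
  by rewrite inE ug orbT.
by apply: subset_trans eg _; apply/subsetP => x xg; rewrite inE /= xg orbT.
Qed.

(* A tour starting at [a] and ready to be closed at the root: if the newest
   vertex [v] is [a] itself, it is put in front of the tour from its parent;
   otherwise the tour makes a detour from the parent of [v] to [v]. *)
Fixpoint tour g (a : V) : seq V :=
  if g is p :: g' then
    if p.1 == a then p.1 :: tour g' p.2 else insert_after p.1 p.2 (tour g' a)
  else [::].

(** Source of the factor 2: a tree edge is paid once if its lower end becomes the new start, and
    twice if it is a detour. *)
Lemma tourP (w : {set V} -> rat) T r g a : metric w -> grown T r g -> a \in unzip1 g ->
  [/\ perm_eq (tour g a) (unzip1 g), exists s, tour g a = a :: s &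
    (plen w a (rcons (tour g a) r) <= 2 * \sum_(p <- g) dist w p.1 p.2)%R].
Proof.
move=> wM gg; elim: gg a => [|v u g' gg IH vg ug vu] a.
  rewrite inE => /eqP -> /=; rewrite eqxx; split=> //; first by exists [::].
  by rewrite /= big_seq1 distxx; lra.
rewrite inE big_cons /=; case: eqVneq => [-> _|av /= ag].
  have [h1 [s h2] h3] := IH u ug; split.
  - by rewrite perm_cons.
  - by exists (tour g' u).
  rewrite /= distxx add0r.
  have := plen_triangle wM v u (rcons (tour g' u) r); have := dist_ge0 wM v u.
  by move: h3; move: (plen _ _ _) (plen _ _ _) (bigop.body _ _ _) => x y z; lra.
have [h1 [s h2] h3] := IH a ag.
have uL : u \in tour g' a by rewrite (perm_mem h1).
split; last 1 first.
- apply: le_trans (plen_insert_after _ _ _ wM uL) _.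
  by move: h3; move: (plen _ _ _) (bigop.body _ _ _) => x z; lra.
- by apply: perm_trans (insert_after_perm _ uL) _; rewrite perm_cons.
by rewrite h2; apply: insert_after_head.
Qed.

(** The edge list comes in arbitrary order and orientation, so either end may be the one already
    reached, and an edge met too early waits for a later round. *)
Definition grow_edge g (e : V * V) :=
  if e.1 \in unzip1 g then if e.2 \in unzip1 g then g else (e.2, e.1) :: g
  else if e.2 \in unzip1 g then (e.1, e.2) :: g else g.

Definition grow_round es g := foldl grow_edge g es.

Lemma grow_edge_sub g e : {subset unzip1 g <= unzip1 (grow_edge g e)}.
Proof.
by move=> x xg; rewrite /grow_edge; do 2![case: ifP => _] => //; rewrite inE xg orbT.
Qed.

Lemma grow_round_sub es g : {subset unzip1 g <= unzip1 (grow_round es g)}.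
Proof.
by elim: es g => [g x|e es IH g x xg] //=; apply: IH; apply: grow_edge_sub.
Qed.

Lemma grow_round_grown T r es g : {in es, forall e, adj T e.1 e.2} ->
  grown T r g -> grown T r (grow_round es g).
Proof.
elim: es g => //= e es IH g Te gg; apply: IH; first by move=> f fe; apply: Te; rewrite inE fe orbT.
have Tee := Te e (mem_head _ _).
rewrite /grow_edge; case: ifP => e1; case: ifP => e2 //; apply: grown_step; rewrite ?e1 ?e2 //.
by rewrite adj_sym.
Qed.

Lemma grow_round_edge es g x y : x \in unzip1 g -> (x, y) \in es \/ (y, x) \in es ->
  y \in unzip1 (grow_round es g).
Proof.
elim: es g => [|e es IH] g xg; first by case.
rewrite !inE /=; have [E|En] := boolP (e \in [:: (x, y); (y, x)]).
  move=> _; apply: grow_round_sub; rewrite /grow_edge.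
  by move: E; rewrite !inE => /orP[]/eqP-> /=; rewrite xg; case: ifP => //; rewrite /= inE eqxx.
move: En; rewrite !inE negb_or => /andP[/negbTE e1 /negbTE e2].
by rewrite !(eq_sym _ e) e1 e2 /=; apply: IH; apply: grow_edge_sub.
Qed.

(** Each round reaches at least one edge further along any path from the root, and a simple path has
    fewer than [#|V|] edges. *)
Lemma growP T r es k : connected T -> r \in verts T -> edges T = edge_set es ->
  #|V| <= k -> let g := iter k (grow_round es) [:: (r, r)] in
  grown T r g /\ {subset verts T <= unzip1 g}.
Proof.
move=> cT rT Ees Vk g; split.
  rewrite /g; elim: k {Vk g} => [|k IH]; first exact: grown_root.
  rewrite iterS; apply: grow_round_grown IH => e ee.
  by rewrite /adj Ees; apply/edge_setP; left; case: e ee.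
have reach p x i : path (adj T) x p -> x \in unzip1 (iter i (grow_round es) [:: (r, r)]) ->
    last x p \in unzip1 (iter (i + size p) (grow_round es) [:: (r, r)]).
  elim: p x i => [|y p IH] x i /=; first by rewrite addn0.
  move=> /andP[xy yp] xi; rewrite addnS -addSn; apply: IH => //.
  rewrite iterS; apply: grow_round_edge xi _; apply/edge_setP; by rewrite -Ees.
move=> x xT; have /connectP[q rq ->] := cT.2 _ _ rT xT.
case/shortenP: rq => p rp up _.
have := reach p r 0 rp; rewrite /= inE eqxx add0n => /(_ isT).
have pk : size p <= k.
  by have := card_uniqP up => /= h; apply: leq_trans Vk; rewrite ltnW // -h max_card.
rewrite /g -(subnK pk) iterD.
elim: (k - size p) => //= n IH h; apply: grow_round_sub; exact: IH.
Qed.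

End Growth.

(** The guarantee of the given algorithm speaks only of optimal solutions, so one must be exhibited;
    subgraphs are pairs of finite sets, hence finitely many. *)
Lemma optimal_exists (I : instance) (T : subgraph 'I_(nverts I)) :
  @feasible SMT I T -> exists Topt, @optimal SMT I Topt.
Proof.
move=> fT; pose F (p : {set 'I_(nverts I)} * {set {set 'I_(nverts I)}}) := Subgraph p.1 p.2.
pose P p := `[< @feasible SMT I (F p) >].
have P0 : P (verts T, edges T) by apply/asboolP; case: (T) fT.
case: (arg_minP (fun p => weight (@edge_weight I) (F p)) P0) => p /asboolP fp mp.
exists (F p); split=> // T' fT'.
have /mp : P (verts T', edges T') by apply/asboolP; case: (T') fT'.
by case: (T').
Qed.

Lemma path_graph_inner (V : finType) (y z x : V) m :
  uniq (y :: rcons m z) -> x \in m -> ~ leaf (path_graph (y :: rcons m z)) x.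
Proof.
move=> us xm; case/splitPr: xm us => m1 m2.
have -> : y :: rcons (m1 ++ x :: m2) z = belast y m1 ++ [:: last y m1, x & rcons m2 z].
  by rewrite -cat_rcons -lastI rcons_cat.
by case: m2 => [|b q] us; apply: (path_graph_interior us).
Qed.

(** * The path that is returned, and the single-vertex solution *)

Section ThePath.
Variables (V : finType) (w : {set V} -> rat) (wM : metric w) (R : {set V}).

(** The order is [x2], [r2], the reversed tour ending in [r1], then [x1]. Filtering removes [r2],
    already placed, and [x1], [x2], which may be Steiner vertices of the tree. The [catrev] mirrors
    a fold that pushes vertices onto [[:: x1]]. *)
Definition closed_path (L : seq V) (r2 x1 x2 : V) :=
  [:: x2, r2 & catrev [seq x <- L | x \notin [:: x1; x2; r2]] [:: x1]].

(** Terminals lie strictly between the ends [x2] and [x1], so none is a leaf. The middle part is a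
    shortcut of the tour closed at [r2], costing at most twice the tree. *)
Lemma closed_pathP (T : subgraph V) g r1 r2 x1 x2 :
  steiner_tree R T -> grown T r2 g -> {subset verts T <= unzip1 g} ->
  r1 \in R -> r2 \in R -> r1 != r2 -> x1 \notin R -> x2 \notin R -> x1 != x2 ->
  let S := path_graph (closed_path (tour g r1) r2 x1 x2) in
  [/\ steiner_tree R S, {in R, forall x, ~ leaf S x} &
    (weight w S <= 2 * weight w T + (w [set r1; x1] + w [set r2; x2]))%R].
Proof.
move=> [sT cT aT RT] gg Tg r1R r2R r12 x1R x2R x12 S.
have neqR x y : x \in R -> y \notin R -> x != y by move=> xR; apply: contraNneq => <-.
have [Lg [L' EL] Lw] := tourP wM gg (Tg _ (subsetP RT _ r1R)).
set F := [seq x <- tour g r1 | x \notin [:: x1; x2; r2]].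
have Es : closed_path (tour g r1) r2 x1 x2 = x2 :: rcons (r2 :: rev F) x1.
  by rewrite /closed_path catrevE cats1.
have us : uniq (x2 :: rcons (r2 :: rev F) x1).
  have uF : uniq F by rewrite filter_uniq // (perm_uniq Lg) (grown_uniq gg).
  rewrite rcons_cons !cons_uniq !(inE, mem_rcons) !rcons_uniq rev_uniq uF.
  rewrite !mem_rev !mem_filter !inE !eqxx !orbT /= !andbT !orbF !negb_or.
  by rewrite (eq_sym x2 r2) (eq_sym x2 x1) x12 !neqR.
have RS : {subset R <= x2 :: rcons (r2 :: rev F) x1}.
  move=> x xR; rewrite inE mem_rcons inE inE mem_rev mem_filter !inE.
  rewrite (perm_mem Lg) Tg ?(subsetP RT) //.
  rewrite (negbTE (neqR _ _ xR x1R)) (negbTE (neqR _ _ xR x2R)).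
  by case: (x =P r2); rewrite ?orbT.
rewrite /S Es; split.
- split; [exact: path_graph_subgraph|exact: path_graph_connected|exact: path_graph_acyclic|].
  by apply/subsetP => x /RS xs; rewrite /= in_set.
- move=> x xR; apply: path_graph_inner us _.
  have := RS x xR; rewrite inE mem_rcons inE.
  by rewrite (negbTE (neqR _ _ xR x1R)) (negbTE (neqR _ _ xR x2R)).
apply: le_trans (path_graph_weight wM us) _.
rewrite rcons_cons /= plen_rev revK {1}/dist eq_sym (negbTE (neqR _ _ r2R x2R)).
have -> : F = r1 :: [seq x <- L' | x \notin [:: x1; x2; r2]].
  by rewrite /F EL /= !inE !negb_or r12 (neqR _ _ r1R x1R) (neqR _ _ r1R x2R).
have /= h1 := plen_filter wM (fun x => x \notin [:: x1; x2; r2]) r1 L' r2.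
have h2 := grown_weight wM sT gg.
move: Lw; rewrite EL /= distxx add0r => Lw.
rewrite /= {1}/dist eq_sym (negbTE (neqR _ _ r1R x1R)) (setUC [set x2]) (setUC [set x1]).
by move: h1 h2 Lw; move: (plen _ _ _) (plen _ _ _) (bigop.body _ _ _) => a b c; lra.
Qed.

Lemma single_vertexP r : R \subset [set r] ->
  let S := path_graph [:: r] in
  [/\ steiner_tree R S, {in R, forall x, ~ leaf S x} & weight w S = 0%R].
Proof.
move=> Rr S; have E0 : edges S = set0 by rewrite /= /edge_set set_nil.
split.
- split; [exact: path_graph_subgraph|exact: path_graph_connected|exact: path_graph_acyclic|].
  by apply: subset_trans Rr _; apply/subsetP => x; rewrite !inE.
- move=> x _ [_]; rewrite /degree E0 => /eqP; rewrite eqn_leq => /andP[_].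
  by rewrite card_gt0 => /set0Pn[e]; rewrite !inE.
by rewrite /weight E0 big_set0.
Qed.

End ThePath.

(** * The algorithm as a function on values *)

Definition step (f : value -> value -> value -> value) (v : value) :=
  f (val_hd v) (val_hd (val_tl v)) (val_tl (val_tl v)).

Lemma additive_step f p : polyb p ->
  (forall e a x, bitsize (f e a x) <= bitsize a + p (bitsize e + bitsize x)) ->
  additive_growth (step f).
Proof.
move=> [k pk] H; exists k => e a x; apply: leq_trans (H e a x) _.
by rewrite leq_add2l pk.
Qed.

Lemma additive_lin f c :
  (forall e a x, bitsize (f e a x) <= bitsize a + c * (bitsize e + bitsize x)) ->
  additive_growth (step f).
Proof. by apply: (@additive_step _ (fun n => c * n)); polyb. Qed.

(** For nested loops: the inner fold starts from the outer accumulator, while its list and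
    environment are bounded without it, so its growth is again independent of that accumulator. *)
Lemma additive_fold h f P : polyb P -> additive_growth h ->
  (forall e a x, exists e' l, [/\ f e a x = vfold h e' a l,
     bitsize e' <= P (bitsize e + bitsize x) & bitsize l <= P (bitsize e + bitsize x)]) ->
  additive_growth (step f).
Proof.
move=> PP /bitsize_vfold[k hk] H.
apply: (@additive_step _ (fun n => P n * (P n + P n + 2) ^ k)); first by polyb.
move=> e a x; have [e' [l [-> he hl]]] := H e a x.
apply: leq_trans (hk _ _ _) _; rewrite leq_add2l leq_mul //.
by apply: leq_expW; rewrite addn2 !ltnS leq_add.
Qed.

Ltac pt :=
  lazymatch goal with
  | |- polytime (fun v => v) => exact: polytime_id
  | |- polytime val_hd => exact: (polytime_hd polytime_id)
  | |- polytime val_tl => exact: (polytime_tl polytime_id)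
  | |- polytime (fun v => val_hd _) => apply: polytime_hd; pt
  | |- polytime (fun v => val_tl _) => apply: polytime_tl; pt
  | |- polytime (fun v => Pair _ _) => apply: polytime_pair; pt
  | |- polytime (fun v => Atom (nat_of_bool (is_pair _))) => apply: polytime_is_pair; pt
  | |- polytime (fun v => Atom _) => exact: polytime_const
  | |- polytime (fun v => vif _ _ _) => apply: polytime_if; pt
  | |- polytime (fun v => veq _ _) => apply: polytime_eq; pt
  | |- polytime (fun v => vleq _ _) => apply: polytime_leq; pt
  | |- polytime (fun v => vadd _ _) => apply: polytime_add; pt
  | |- polytime (fun v => vsub _ _) => apply: polytime_sub; pt
  | |- polytime (fun v => vmul _ _) => apply: polytime_mul; pt
  | |- polytime (fun v => vfold _ _ _ _) => apply: polytime_fold; pt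
  | _ => try solve [auto with pt]
  end.

Ltac additive_simple c :=
  apply: (@additive_lin _ c) => e a x; rewrite /vif;
  have := bitsize_gt0 e; have := bitsize_gt0 x; have := bitsize_gt0 a;
  have := bitsize_hd e; have := bitsize_hd x; have := bitsize_hd a;
  have := bitsize_tl e; have := bitsize_tl x; have := bitsize_hdtl a;
  do ?[case: ifP => _]; rewrite /= ?trunc_log0 ?trunc_log1; lia.

Definition mem_step y acc p := vif (veq y (val_hd p)) (Atom 1) acc.
Definition vmem y g := vfold (step mem_step) y (Atom 0) g.

Lemma polytime_mem_step : polytime (step mem_step).
Proof. by rewrite /step /mem_step; pt. Qed.

Lemma mem_step_growth : additive_growth (step mem_step).
Proof. by rewrite /mem_step; additive_simple 2. Qed.
#[local] Hint Resolve polytime_mem_step mem_step_growth : pt.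

Lemma polytime_vmem f g : polytime f -> polytime g -> polytime (fun v => vmem (f v) (g v)).
Proof. by move=> pf pg; rewrite /vmem; pt. Qed.

Definition grow_edge_step (_ : value) g e :=
  vif (vmem (val_hd e) g)
    (vif (vmem (val_tl e) g) g (Pair (Pair (val_tl e) (val_hd e)) g))
    (vif (vmem (val_tl e) g) (Pair e g) g).
Definition grow_round_step es g (_ : value) :=
  vfold (step grow_edge_step) (Atom 0) g es.
(** [rows] is only a clock: it has one entry per vertex, which is the number of rounds required. *)
Definition vgrow es r rows :=
  vfold (step grow_round_step) es (Pair (Pair r r) (Atom 0)) rows.

Lemma polytime_grow_edge_step : polytime (step grow_edge_step).
Proof. by rewrite /step /grow_edge_step; pt; apply: polytime_vmem; pt. Qed.

Lemma grow_edge_growth : additive_growth (step grow_edge_step).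
Proof. by rewrite /grow_edge_step; additive_simple 4. Qed.
#[local] Hint Resolve polytime_grow_edge_step grow_edge_growth : pt.

Lemma polytime_grow_round_step : polytime (step grow_round_step).
Proof. by rewrite /step /grow_round_step; pt. Qed.

Lemma grow_round_growth : additive_growth (step grow_round_step).
Proof.
apply: (additive_fold polyb_id grow_edge_growth) => e a x.
by exists (Atom 0), e; have := bitsize_gt0 e; split=> //=; rewrite ?trunc_log0; lia.
Qed.
#[local] Hint Resolve polytime_grow_round_step grow_round_growth : pt.

Lemma polytime_vgrow f g h : polytime f -> polytime g -> polytime h -> polytime (fun v => vgrow (f v) (g v) (h v)).
Proof. by move=> pf pg ph; rewrite /vgrow; pt. Qed.

Definition rev_step (_ acc x : value) := Pair x acc.
Definition vrev l := vfold (step rev_step) (Atom 0) (Atom 0) l.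
(** The state is a flag, telling that the insertion is done, and the output so far in reverse order;
    [vrev] restores the order. *)
Definition insert_step p st x :=
  vif (vif (val_hd st) (Atom 0) (veq x (val_tl p)))
    (Pair (Atom 1) (Pair (val_hd p) (Pair x (val_tl st))))
    (Pair (val_hd st) (Pair x (val_tl st))).
Definition vinsert p s :=
  vrev (val_tl (vfold (step insert_step) p (Pair (Atom 0) (Atom 0)) s)).

Lemma insert_stepE p fl out x : insert_step p (Pair fl out) x =
  vif (vif fl (Atom 0) (veq x (val_tl p)))
    (Pair (Atom 1) (Pair (val_hd p) (Pair x out))) (Pair fl (Pair x out)).
Proof. by []. Qed.

Lemma polytime_rev_step : polytime (step rev_step).
Proof. by rewrite /step /rev_step; pt. Qed.

Lemma rev_growth : additive_growth (step rev_step).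
Proof. by rewrite /rev_step; additive_simple 1. Qed.

Lemma polytime_insert_step : polytime (step insert_step).
Proof. by rewrite /step /insert_step; pt. Qed.

Lemma insert_growth : additive_growth (step insert_step).
Proof. by rewrite /insert_step; additive_simple 8. Qed.
#[local] Hint Resolve polytime_rev_step rev_growth polytime_insert_step insert_growth : pt.

Lemma polytime_vinsert f g : polytime f -> polytime g -> polytime (fun v => vinsert (f v) (g v)).
Proof. by move=> pf pg; rewrite /vinsert /vrev; pt. Qed.

(** In [build_step] the accumulator is the very list traversed by [vinsert], so [additive_fold] does
    not apply and the size is counted directly. *)
Lemma bitsize_vinsert p s : bitsize (vinsert p s) <= bitsize s + bitsize p + 4.
Proof.
have rv acc l : bitsize (vfold (step rev_step) (Atom 0) acc l) <= bitsize acc + bitsize l.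
  elim: l acc => [n|x _ l IH] acc /=; first by lia.
  by apply: leq_trans (IH _) _; rewrite /=; lia.
(* The flag limits the fold to a single insertion. *)
have ins fl out l : bitsize (val_tl (vfold (step insert_step) p (Pair fl out) l)) <=
    bitsize out + bitsize l + (if truthy fl then 0 else (bitsize (val_hd p)).+1).
  elim: l fl out => [n|x _ l IH] fl out; first by rewrite /=; case: ifP => _; lia.
  rewrite -[vfold _ _ _ (Pair x l)]/(vfold (step insert_step) p (insert_step p (Pair fl out) x) l).
  rewrite insert_stepE /vif; case fl1: (truthy fl) => /=.
    by apply: leq_trans (IH _ _) _; rewrite fl1 /=; lia.
  by case: ifP => _; apply: leq_trans (IH _ _) _; rewrite ?fl1 /=; lia.
apply: leq_trans (rv _ _) _; have := ins (Atom 0) (Atom 0) s.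
have := bitsize_hd p; rewrite /= trunc_log0; lia.
Qed.

(** [tour] passes its start down the recursion and builds on the way back, which takes two folds:
    [mark_step] goes from newest to oldest, follows the start and records which case applies;
    [build_step] replays the reversed marks from oldest to newest. *)
Definition build_step (_ : value) s m :=
  vif (val_hd m) (Pair (val_hd (val_tl m)) s) (vinsert (val_tl m) s).
Definition mark_step (_ : value) st p :=
  vif (veq (val_hd p) (val_hd st))
    (Pair (val_tl p) (Pair (Pair (Atom 1) p) (val_tl st)))
    (Pair (val_hd st) (Pair (Pair (Atom 0) p) (val_tl st))).
Definition vtour g a :=
  vfold (step build_step) (Atom 0) (Atom 0)
    (val_tl (vfold (step mark_step) (Atom 0) (Pair a (Atom 0)) g)).

Lemma polytime_build_step : polytime (step build_step).
Proof. by rewrite /step /build_step; pt; apply: polytime_vinsert; pt. Qed.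

Lemma build_growth : additive_growth (step build_step).
Proof.
apply: (@additive_lin _ 6) => e a x; rewrite /build_step /vif.
have := bitsize_vinsert (val_tl x) a; have := bitsize_gt0 e.
have := bitsize_hd (val_tl x); have := bitsize_tl x.
by case: ifP => _; rewrite /=; lia.
Qed.

Lemma polytime_mark_step : polytime (step mark_step).
Proof. by rewrite /step /mark_step; pt. Qed.

Lemma mark_growth : additive_growth (step mark_step).
Proof. by rewrite /mark_step; additive_simple 8. Qed.
#[local] Hint Resolve polytime_build_step build_growth polytime_mark_step mark_growth : pt.

Lemma polytime_vtour f g : polytime f -> polytime g -> polytime (fun v => vtour (f v) (g v)).
Proof. by move=> pf pg; rewrite /vtour; pt. Qed.

Definition keep_step e acc x :=
  vif (veq x (val_hd e)) acc (vif (veq x (val_hd (val_tl e))) acc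
    (vif (veq x (val_tl (val_tl e))) acc (Pair x acc))).
Definition vclosed_path s r2 x1 x2 :=
  Pair x2 (Pair r2
    (vfold (step keep_step) (Pair x1 (Pair x2 r2)) (Pair x1 (Atom 0)) s)).

Lemma polytime_keep_step : polytime (step keep_step).
Proof. by rewrite /step /keep_step; pt. Qed.

Lemma keep_growth : additive_growth (step keep_step).
Proof. by rewrite /keep_step; additive_simple 2. Qed.
#[local] Hint Resolve polytime_keep_step keep_growth : pt.

Lemma polytime_vclosed_path f g h i : polytime f -> polytime g -> polytime h -> polytime i ->
  polytime (fun v => vclosed_path (f v) (g v) (h v) (i v)).
Proof. by move=> pf pg ph pi; rewrite /vclosed_path; pt. Qed.

Definition steps_step (_ : value) st x :=
  Pair x (Pair (Pair (val_hd st) x) (val_tl st)).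
Definition vgraph s :=
  Pair s (val_tl (vfold (step steps_step) (Atom 0) (Pair (val_hd s) (Atom 0)) (val_tl s))).

Lemma polytime_steps_step : polytime (step steps_step).
Proof. by rewrite /step /steps_step; pt. Qed.

Lemma steps_growth : additive_growth (step steps_step).
Proof. by rewrite /steps_step; additive_simple 6. Qed.
#[local] Hint Resolve polytime_steps_step steps_growth : pt.

Lemma polytime_vgraph f : polytime f -> polytime (fun v => vgraph (f v)).
Proof. by move=> pf; rewrite /vgraph; pt. Qed.

(* The counter is clipped to the number [n] of vertices, so that the entries of
   the output have a size that does not depend on the accumulator. *)
Definition tag_step n st flag :=
  Pair (vadd (val_hd st) (Atom 1))
    (Pair (val_tl (val_hd (val_tl st)))
      (Pair (Pair (vsub n (vsub n (val_hd st)))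
                  (Pair flag (val_hd (val_hd (val_tl st)))))
            (val_tl (val_tl st)))).
(** A fold runs over one list only, so the second list travels in the accumulator and is consumed in
    step with the flags. The result is reversed, which is harmless for collecting candidates. *)
Definition vtag nf l := val_tl (val_tl
  (vfold (step tag_step) (val_hd nf) (Pair (Atom 0) (Pair l (Atom 0))) (val_tl nf))).

Lemma polytime_tag_step : polytime (step tag_step).
Proof. by rewrite /step /tag_step; pt. Qed.

Lemma tag_growth : additive_growth (step tag_step).
Proof.
apply: (@additive_lin _ 20) => n st x; rewrite /tag_step.
have := bitsize_add (val_hd st) (Atom 1).
have := bitsize_sub n (vsub n (val_hd st)).
have := bitsize_hdtl st; have := bitsize_hdtl (val_tl st).
have := bitsize_hdtl (val_hd (val_tl st)); have := bitsize_gt0 n; have := bitsize_gt0 x.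
rewrite -/(vadd _ _) -/(vsub _ _); move: (vadd _ _) (vsub _ (vsub _ _)) => a b.
by rewrite /= trunc_log1; lia.
Qed.
#[local] Hint Resolve polytime_tag_step tag_growth : pt.

Lemma polytime_vtag f g : polytime f -> polytime g -> polytime (fun v => vtag (f v) (g v)).
Proof. by move=> pf pg; rewrite /vtag; pt. Qed.

Definition cand_step i out t :=
  vif (val_hd (val_tl t)) out (Pair (Pair i (Pair (val_hd t) (val_tl (val_tl t)))) out).
Definition cands_step nf out t :=
  vif (val_hd (val_tl t))
    (vfold (step cand_step) (val_hd t) out (vtag nf (val_tl (val_tl t)))) out.
Definition vcands nf rows := vfold (step cands_step) nf (Atom 0) (vtag nf rows).

Lemma polytime_cand_step : polytime (step cand_step).
Proof. by rewrite /step /cand_step; pt. Qed.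

Lemma cand_growth : additive_growth (step cand_step).
Proof.
apply: (@additive_lin _ 6) => e a x; rewrite /cand_step /vif.
have := bitsize_gt0 e; have := bitsize_hd x; have := bitsize_tl x.
by have := bitsize_tl (val_tl x); case: ifP => _; rewrite /=; lia.
Qed.
#[local] Hint Resolve polytime_cand_step cand_growth : pt.

Lemma polytime_cands_step : polytime (step cands_step).
Proof. by rewrite /step /cands_step; pt; apply: polytime_vtag; pt. Qed.

Lemma cands_growth : additive_growth (step cands_step).
Proof.
have [k hk] : exists k, forall nf l,
    bitsize (vtag nf l) <= (bitsize nf + bitsize l + 3) ^ k.
  have [|k hk] := @polytime_size (fun v => vtag (val_hd v) (val_tl v)).
    by apply: polytime_vtag; pt.
  by exists k => nf l; have := hk (Pair nf l); rewrite /= addn3.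
apply: (@additive_fold (step cand_step) _ (fun n => n + (n + 3) ^ k)); first by polyb.
  exact: cand_growth.
move=> e a x; rewrite /cands_step /vif; case: ifP => _.
  eexists _, _; split; first reflexivity.
    by have := bitsize_hd x; lia.
  apply: leq_trans (hk _ _) _; apply: leq_trans (leq_addl _ _); apply: leq_expW.
  by have := bitsize_tl x; have := bitsize_tl (val_tl x); lia.
(* A nonterminal leaves the accumulator unchanged, which is the fold over an empty list. *)
by exists (Atom 0), (Atom 0); split=> //; have := bitsize_gt0 e; rewrite /= trunc_log0; lia.
Qed.
#[local] Hint Resolve polytime_cands_step cands_growth : pt.

Lemma polytime_vcands f g : polytime f -> polytime g -> polytime (fun v => vcands (f v) (g v)).
Proof. by move=> pf pg; rewrite /vcands; pt; apply: polytime_vtag; pt. Qed.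

(** Fractions are not reduced: costs are only compared, by cross multiplication, so no gcd has to be
    computed. *)
Definition vratadd p q :=
  Pair (vadd (vmul (val_hd p) (val_tl q)) (vmul (val_hd q) (val_tl p)))
       (vmul (val_tl p) (val_tl q)).
Definition vratleq p q := vleq (vmul (val_hd p) (val_tl q)) (vmul (val_hd q) (val_tl p)).
Definition vcost c := vratadd (val_tl (val_tl (val_hd c))) (val_tl (val_tl (val_tl c))).
(** [Atom 0] means that no admissible pair has been found yet. The pair itself is stored and its
    cost recomputed, so a step keeps or replaces the accumulator and never builds on it. *)
Definition best1_step c1 best c2 :=
  vif (veq (val_hd c1) (val_hd c2)) best
    (vif (veq (val_hd (val_tl c1)) (val_hd (val_tl c2))) best
      (vif (vif (Atom (is_pair best)) (vratleq (vcost best) (vcost (Pair c1 c2))) (Atom 0))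
        best (Pair c1 c2))).
Definition best_step cs best c1 := vfold (step best1_step) c1 best cs.
Definition vbest cs := vfold (step best_step) cs (Atom 0) cs.

Lemma polytime_best1_step : polytime (step best1_step).
Proof. by rewrite /step /best1_step /vratleq /vcost /vratadd; pt. Qed.

Lemma best1_growth : additive_growth (step best1_step).
Proof.
apply: (@additive_lin _ 2) => e a x; rewrite /best1_step /vif.
have := bitsize_gt0 e; have := bitsize_gt0 x.
by do ?[case: ifP => _]; rewrite /=; lia.
Qed.
#[local] Hint Resolve polytime_best1_step best1_growth : pt.

Lemma polytime_best_step : polytime (step best_step).
Proof. by rewrite /step /best_step; pt. Qed.

Lemma best_growth : additive_growth (step best_step).
Proof.
apply: (additive_fold polyb_id best1_growth) => e a x.
by exists x, e; split=> //=; lia.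
Qed.
#[local] Hint Resolve polytime_best_step best_growth : pt.

Lemma polytime_vbest f : polytime f -> polytime (fun v => vbest (f v)).
Proof. by move=> pf; rewrite /vbest; pt. Qed.

(** Without an admissible pair there is at most one terminal, which heads the first candidate. If
    there is none, [cs] is [Atom 0], and totality of [val_hd] yields vertex 0. *)
Definition vresult best cs es rows :=
  vif (Atom (is_pair best))
    (vgraph (vclosed_path
      (vtour (vgrow es (val_hd (val_tl best)) rows) (val_hd (val_hd best)))
      (val_hd (val_tl best))
      (val_hd (val_tl (val_hd best))) (val_hd (val_tl (val_tl best)))))
    (vgraph (Pair (val_hd (val_hd cs)) (Atom 0))).

(** Only the edge list of the Steiner tree is read: its vertices are recovered by growing from the
    terminal [r2], which lies in the tree. *)
Definition vinternal v :=
  let inp := val_hd v in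
  let rows := val_hd (val_tl inp) in
  let cs := vcands (Pair (val_hd inp) (val_tl (val_tl inp))) rows in
  vresult (vbest cs) cs (val_tl (val_tl v)) rows.

Lemma polytime_vinternal : polytime vinternal.
Proof.
rewrite /vinternal.
have pc : polytime (fun v => vcands (Pair (val_hd (val_hd v)) (val_tl (val_tl (val_hd v))))
    (val_hd (val_tl (val_hd v)))) by apply: polytime_vcands; pt.
have pb := polytime_vbest pc.
rewrite /vresult; pt; apply: polytime_vgraph; last by pt.
by apply: polytime_vclosed_path; [apply: polytime_vtour; [apply: polytime_vgrow|]|..]; pt.
Qed.

(** * Correctness *)

Lemma vfold_cons f e a x l :
  vfold (step f) e a (Pair x l) = vfold (step f) e (f e a x) l.
Proof. by []. Qed.

Section Encodings.
Variable n : nat.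
Implicit Types (x y : 'I_n) (s : seq 'I_n) (p : 'I_n * 'I_n) (g : seq ('I_n * 'I_n)).

Let enc_v x : value := Atom x.
Let enc_p p : value := Pair (Atom p.1) (Atom p.2).

Lemma veqE x y : veq (Atom x) (Atom y) = Atom (x == y).
Proof. by rewrite /veq /vmul /vleq /= -val_eqE eqn_leq mulnb. Qed.

Lemma vifE (b : bool) u v : vif (Atom b) u v = if b then u else v.
Proof. by case: b. Qed.

Lemma vmemE y g : vmem (Atom y) (enc_seq enc_p g) = Atom (y \in unzip1 g).
Proof.
rewrite /vmem; suff H (b : bool) :
    vfold (step mem_step) (Atom y) (Atom b) (enc_seq enc_p g) = Atom (b || (y \in unzip1 g)).
  exact: (H false).
elim: g b => [|p g IH] b; first by rewrite orbF.
rewrite vfold_cons /mem_step veqE vifE inE; case: eqP => _; last exact: IH.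
by rewrite (IH true) orbT.
Qed.

Lemma grow_edgeE e g p :
  grow_edge_step e (enc_seq enc_p g) (enc_p p) = enc_seq enc_p (grow_edge g p).
Proof.
rewrite /grow_edge_step /= !vmemE !vifE /grow_edge.
by case: ifP => _; case: ifP => _ //; case: p.
Qed.

Lemma vgrowE (A : Type) (h : A -> value) es x (t : seq A) :
  vgrow (enc_seq enc_p es) (Atom x) (enc_seq h t) =
  enc_seq enc_p (iter (size t) (grow_round es) [:: (x, x)]).
Proof.
rewrite /vgrow -[Pair _ _]/(enc_seq enc_p [:: (x, x)]).
elim: t [:: (x, x)] => [|a t IH] g //.
rewrite [enc_seq h _]/= vfold_cons [size _]/= iterSr -IH; congr vfold.
rewrite /grow_round_step /grow_round; elim: (es) g => [|e es' IH'] g //.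
by rewrite [enc_seq _ (_ :: _)]/= vfold_cons grow_edgeE IH'.
Qed.

Lemma vrevE (A : Type) (h : A -> value) (acc t : seq A) :
  vfold (step rev_step) (Atom 0) (enc_seq h acc) (enc_seq h t) = enc_seq h (catrev t acc).
Proof. by elim: t acc => [|a t IH] acc //; rewrite /= -IH. Qed.

Lemma vinsertE p s :
  vinsert (enc_p p) (enc_seq enc_v s) = enc_seq enc_v (insert_after p.1 p.2 s).
Proof.
have done_ out t : vfold (step insert_step) (enc_p p) (Pair (Atom 1) (enc_seq enc_v out))
    (enc_seq enc_v t) = Pair (Atom 1) (enc_seq enc_v (catrev t out)).
  elim: t out => [|x t IH] out //.
  by rewrite [enc_seq _ (_ :: _)]/= vfold_cons insert_stepE -[RHS]IH.
have todo out t : val_tl (vfold (step insert_step) (enc_p p) (Pair (Atom 0) (enc_seq enc_v out))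
    (enc_seq enc_v t)) = enc_seq enc_v (catrev (insert_after p.1 p.2 t) out).
  elim: t out => [|x t IH] out //.
  rewrite [enc_seq _ (_ :: _)]/= vfold_cons insert_stepE (vifE false) [val_tl _]/= veqE vifE.
  case xp: (x == p.2); rewrite /= xp; last exact: (IH (x :: out)).
  by rewrite (done_ [:: p.1, x & out]).
by rewrite /vinsert /vrev (todo [::]) (vrevE _ [::]) -![catrev _ [::]]/(rev _) revK.
Qed.

Lemma vtourE g x : vtour (enc_seq enc_p g) (Atom x) = enc_seq enc_v (tour g x).
Proof.
rewrite /vtour.
(* [O] holds the marks of the newer pairs; they are pending operations, applied once the tour of the
   remaining list is built. *)
suff H O : vfold (step build_step) (Atom 0) (Atom 0)
    (val_tl (vfold (step mark_step) (Atom 0) (Pair (Atom x) O) (enc_seq enc_p g))) =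
  vfold (step build_step) (Atom 0) (enc_seq enc_v (tour g x)) O by rewrite H.
elim: g x O => [|p g IH] x O //.
rewrite [enc_seq _ (_ :: _)]/= vfold_cons /mark_step /= veqE vifE.
case: (p.1 == x); rewrite IH vfold_cons; congr vfold.
by rewrite /build_step /vif /= -vinsertE.
Qed.

Lemma vclosed_pathE s (r2 x1 x2 : 'I_n) :
  vclosed_path (enc_seq enc_v s) (Atom r2) (Atom x1) (Atom x2) =
  enc_seq enc_v (closed_path s r2 x1 x2).
Proof.
rewrite /vclosed_path /closed_path /=; congr (Pair _ (Pair _ _)).
rewrite -[Pair (Atom x1) (Atom 0)]/(enc_seq enc_v [:: x1]).
elim: s [:: x1] => [|y s IH] acc //.
rewrite [enc_seq _ (_ :: _)]/= vfold_cons /keep_step /= !veqE !vifE !inE !negb_or.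
by do 3![case: eqP => _ //=]; rewrite -IH.
Qed.

Lemma vgraph_represents x s : represents (vgraph (enc_seq enc_v (x :: s))) (path_graph (x :: s)).
Proof.
exists (x :: s), (rev (steps (x :: s))); split=> //.
  rewrite /vgraph; congr Pair.
  rewrite [val_hd _]/= [val_tl (enc_seq _ _)]/= -/(enc_seq enc_v s) /rev.
  rewrite -[Pair _ _]/(Pair (Atom x) (enc_seq enc_p [::])).
  elim: s x [::] => [|y s IH] x out //.
  by rewrite [enc_seq _ (_ :: _)]/= vfold_cons steps_cons /= -IH.
by apply/setP => e; rewrite !inE map_rev mem_rev.
Qed.

Lemma vtagE (f : 'I_n -> nat) (h : 'I_n -> value) :
  vtag (Pair (Atom n) (enc_seq (fun i : 'I_n => Atom (f i)) (enum 'I_n))) (enc_seq h (enum 'I_n)) =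
  enc_seq (fun i : 'I_n => Pair (Atom i) (Pair (Atom (f i)) (h i))) (rev (enum 'I_n)).
Proof.
rewrite /vtag [val_hd _]/= [val_tl (Pair _ _)]/=; set F := fun i : 'I_n => Pair (Atom _) _.
(* The counter [j] is the index of the head of [s] and never exceeds [n], so the clipped value
   [n - (n - j)] is [j]. *)
have H s j out : map val s = iota j (size s) -> j + size s = n ->
    val_tl (val_tl (vfold (step tag_step) (Atom n)
      (Pair (Atom j) (Pair (enc_seq h s) (enc_seq F out)))
      (enc_seq (fun i : 'I_n => Atom (f i)) s))) = enc_seq F (catrev s out).
  elim: s j out => [|i s IH] j out // E jn; case: E => ij sj.
  have -> : enc_seq F (catrev (i :: s) out) = enc_seq F (catrev s (i :: out)) by [].
  rewrite -(IH j.+1 (i :: out) sj); last by rewrite addSnnS.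
  have jn' : j <= n by rewrite -jn leq_addr.
  have -> : enc_seq F (i :: out) =
      Pair (Pair (Atom (n - (n - j))) (Pair (Atom (f i)) (h i))) (enc_seq F out).
    by rewrite subKn // -ij.
  by rewrite -addn1.
apply: (H (enum 'I_n) 0 [::]); last by rewrite size_enum_ord.
by rewrite val_enum_ord size_enum_ord.
Qed.

Variables (R : {set 'I_n}) (W : 'I_n -> 'I_n -> rat).
Let enc_c p : value := Pair (Atom p.1) (Pair (Atom p.2) (enc_rat (W p.1 p.2))).
Let flags := enc_seq (fun i : 'I_n => Atom (i \in R)) (enum 'I_n).
Let rows := enc_seq (fun i : 'I_n => enc_seq (fun j => enc_rat (W i j)) (enum 'I_n)) (enum 'I_n).

Lemma vcandsE : exists2 cs, vcands (Pair (Atom n) flags) rows = enc_seq enc_c cs &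
  forall p, (p \in cs) = (p.1 \in R) && (p.2 \notin R).
Proof.
have inner (i : 'I_n) out t : exists2 cs, vfold (step cand_step) (Atom i) (enc_seq enc_c out)
    (enc_seq (fun j : 'I_n => Pair (Atom j) (Pair (Atom (j \in R)) (enc_rat (W i j)))) t) =
      enc_seq enc_c cs &
    forall p, (p \in cs) = (p \in out) || [&& p.1 == i, p.2 \in t & p.2 \notin R].
  elim: t out => [|j t IH] out.
    by exists out => // p; rewrite andbF orbF.
  rewrite [enc_seq _ (_ :: _)]/= vfold_cons /cand_step /= vifE.
  case: ifP => jR.
    have [cs -> Hcs] := IH out; exists cs => // p; rewrite Hcs inE.
    by case: (p.2 =P j) => [->|]; rewrite ?jR ?andbF.
  have [cs E Hcs] := IH ((i, j) :: out); exists cs; first by rewrite -E.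
  case=> a b; rewrite Hcs !inE xpair_eqE /=.
  case: (b =P j) => [->|_]; rewrite ?jR ?andbT ?andbF /= ?orbT ?andbT.
    by case: (a == i) (_ \in out) (_ \in t) => [] [] [].
  by [].
have outer out t : exists2 cs, vfold (step cands_step) (Pair (Atom n) flags) (enc_seq enc_c out)
    (enc_seq (fun i : 'I_n => Pair (Atom i) (Pair (Atom (i \in R))
       (enc_seq (fun j => enc_rat (W i j)) (enum 'I_n)))) t) = enc_seq enc_c cs &
    forall p, (p \in cs) = (p \in out) || [&& p.1 \in t, p.1 \in R & p.2 \notin R].
  elim: t out => [|i t IH] out.
    by exists out => // p; rewrite orbF.
  rewrite [enc_seq _ (_ :: _)]/= vfold_cons /cands_step; cbn [val_hd val_tl].
  rewrite vifE; case: ifP => iR; last first.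
    have [cs -> Hcs] := IH out; exists cs => // p; rewrite Hcs inE.
    by case: (p.1 =P i) => [->|]; rewrite ?iR ?andbF.
  rewrite vtagE; have [cs1 -> H1] := inner i out (rev (enum 'I_n)).
  have [cs -> Hcs] := IH cs1; exists cs => // p; rewrite Hcs H1 inE mem_rev mem_enum /=.
  case: (p.1 =P i) => [->|] /=; rewrite ?iR /= ?orbF //.
  by case: (p \in out) (i \in t) (p.2 \in R) => [] [] [].
rewrite /vcands vtagE; have [cs E Hcs] := outer [::] (rev (enum 'I_n)).
by exists cs => // p; rewrite Hcs mem_rev mem_enum.
Qed.

Definition pair_cost (c : ('I_n * 'I_n) * ('I_n * 'I_n)) : rat :=
  (W c.1.1 c.1.2 + W c.2.1 c.2.2)%R.

Lemma vratE (q : rat) : (0 <= q)%R -> q = (`|numq q|%:R / `|denq q|%:R)%R.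
Proof.
move=> q0; rewrite -[LHS]divq_num_den !natr_absz.
by rewrite !ger0_norm ?denq_ge0 ?numq_ge0.
Qed.

Hypothesis W_ge0 : forall x y, (0 <= W x y)%R.

Lemma vcost_leqE c c' :
  vratleq (vcost (Pair (enc_c c.1) (enc_c c.2))) (vcost (Pair (enc_c c'.1) (enc_c c'.2))) =
  Atom (pair_cost c <= pair_cost c')%R.
Proof.
rewrite /pair_cost (vratE (W_ge0 c.1.1 c.1.2)) (vratE (W_ge0 c.2.1 c.2.2)).
rewrite (vratE (W_ge0 c'.1.1 c'.1.2)) (vratE (W_ge0 c'.2.1 c'.2.2)).
rewrite /vratleq /vcost /vratadd /= /vleq /vmul /vadd /=; congr (Atom (nat_of_bool _)).
have d_gt0 q : 0 < `|denq q| by rewrite absz_gt0 denq_neq0.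
move: `|denq (W c.1.1 c.1.2)| `|denq (W c.2.1 c.2.2)| `|denq (W c'.1.1 c'.1.2)|
  `|denq (W c'.2.1 c'.2.2)| (d_gt0 (W c.1.1 c.1.2)) (d_gt0 (W c.2.1 c.2.2))
  (d_gt0 (W c'.1.1 c'.1.2)) (d_gt0 (W c'.2.1 c'.2.2)) => d1 d2 d3 d4 h1 h2 h3 h4.
move: `|numq _| `|numq _| `|numq _| `|numq _| => n1 n2 n3 n4.
have nz d : 0 < d -> (d%:R : rat)%R != 0%R by rewrite pnatr_eq0 -lt0n.
rewrite !addf_div ?nz // -!natrM -!natrD.
rewrite ler_pdivrMr ?ltr0n ?muln_gt0 ?h1 // mulrAC ler_pdivlMr ?ltr0n ?muln_gt0 ?h3 //.
by rewrite -!natrM ler_nat.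
Qed.

Definition valid_pair (c : ('I_n * 'I_n) * ('I_n * 'I_n)) :=
  (c.1.1 != c.2.1) && (c.1.2 != c.2.2).

Definition best_update b c :=
  if valid_pair c then
    if b is Some c' then if (pair_cost c' <= pair_cost c)%R then b else Some c
    else Some c
  else b.

Definition is_best (t : seq (('I_n * 'I_n) * ('I_n * 'I_n))) b :=
  if b is Some c then
    [/\ c \in t, valid_pair c & {in t, forall c', valid_pair c' -> (pair_cost c <= pair_cost c')%R}]
  else {in t, forall c, ~~ valid_pair c}.

Lemma best_updateP t b c : is_best t b -> is_best (rcons t c) (best_update b c).
Proof.
rewrite /best_update; case: ifP => vc.
  case: b => [c'|] /= H; last first.
    split; rewrite ?mem_rcons ?mem_head // => d; rewrite mem_rcons inE => /orP[/eqP -> //|dt].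
    by rewrite (negbTE (H d dt)).
  have [ct vc' mc] := H; case: leP => cc; split=> //.
  - by rewrite mem_rcons inE ct orbT.
  - by move=> d; rewrite mem_rcons inE => /orP[/eqP -> //|]; apply: mc.
  - by rewrite mem_rcons mem_head.
  move=> d; rewrite mem_rcons inE => /orP[/eqP -> //|dt vd].
  by apply: le_trans (ltW cc) (mc d dt vd).
case: b => [c'|] /=.
  move=> [ct vc' mc]; split=> //; first by rewrite mem_rcons inE ct orbT.
  by move=> d; rewrite mem_rcons inE => /orP[/eqP ->|]; [rewrite vc|apply: mc].
by move=> H d; rewrite mem_rcons inE => /orP[/eqP ->|/H//]; rewrite vc.
Qed.

Let enc_b b := if b is Some c then Pair (enc_c c.1) (enc_c c.2) else Atom 0.

Lemma best1_stepE c1 b c2 :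
  best1_step (enc_c c1) (enc_b b) (enc_c c2) = enc_b (best_update b (c1, c2)).
Proof.
rewrite /best1_step /= !veqE !vifE /best_update /valid_pair /=.
case: eqP => _ //=; case: eqP => _ //=.
case: b => [c|] //=.
by rewrite (vcost_leqE c (c1, c2)) vifE; case: ifP.
Qed.

Lemma vbestE cs : exists2 b, vbest (enc_seq enc_c cs) = enc_b b &
  is_best [seq (c1, c2) | c1 <- cs, c2 <- cs] b.
Proof.
have inner c1 t t0 b : is_best t0 b -> exists2 b',
    vfold (step best1_step) (enc_c c1) (enc_b b) (enc_seq enc_c t) = enc_b b' &
    is_best (t0 ++ [seq (c1, c2) | c2 <- t]) b'.
  elim: t t0 b => [|c2 t IH] t0 b H; first by exists b; rewrite ?cats0.
  rewrite [enc_seq _ (_ :: _)]/= vfold_cons best1_stepE /= -cat_rcons.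
  exact/IH/best_updateP.
rewrite /vbest; set E := enc_seq enc_c cs.
suff outer t t0 b : is_best t0 b -> exists2 b',
    vfold (step best_step) E (enc_b b) (enc_seq enc_c t) = enc_b b' &
    is_best (t0 ++ [seq (c1, c2) | c1 <- t, c2 <- cs]) b' by apply: (outer cs [::] None).
elim: t t0 b => [|c1 t IH] t0 b H; first by exists b; rewrite ?cats0.
rewrite [enc_seq _ (_ :: _)]/= vfold_cons /best_step.
have [b1 -> H1] := inner c1 cs t0 b H; have [b' -> H'] := IH _ _ H1.
by exists b' => //=; rewrite catA.
Qed.

End Encodings.

(** * Feasibility of the output and the approximation ratio *)

Section Approximation.
Variable I : instance.
Hypothesis I_valid : valid ISMT I.

Local Notation n := (nverts I).
Local Notation w := (@edge_weight I).
Local Notation R := (terminals I).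

Lemma nverts_gt0 : 0 < n.
Proof.
have [_ h] := I_valid; rewrite -(card_ord n).
by apply: leq_trans (max_card (mem (~: R))); apply: ltnW.
Qed.

(* The second alternative is the degenerate case of at most one terminal. *)
Lemma vinternalP v (T : subgraph 'I_n) : represents v T -> @feasible SMT I T ->
  exists2 S : subgraph 'I_n,
    represents (vinternal (Pair (enc_instance I) v)) S /\ @feasible ISMT I S &
    (exists2 c, [/\ c.1.1 \in R, c.2.1 \in R & valid_pair c] /\
        (weight w S <= 2 * weight w T + pair_cost (dist w) c)%R &
      forall r1 x1 r2 x2, r1 \in R -> x1 \notin R -> r2 \in R -> x2 \notin R ->
        r1 != r2 -> x1 != x2 ->
        (pair_cost (dist w) c <= w [set r1; x1] + w [set r2; x2])%R) \/
    weight w S = 0%R.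
Proof.
have [wM R2] := I_valid.
move=> [vs [es [-> _ Tes]]] fT; have [sT cT aT RT] := fT.
have [cs Ecs csP] := vcandsE R (dist w).
have [b Eb bP] := vbestE (dist_ge0 wM) cs.
move: Ecs; set F := enc_seq _ _; set RW := enc_seq _ _ => Ecs.
(* This holds by computation, as [dist w] unfolds to the zero-diagonal matrix of [enc_instance]. *)
rewrite -[vinternal _]/(vresult (vbest (vcands (Pair (Atom n) F) RW))
  (vcands (Pair (Atom n) F) RW)
  (enc_seq (fun e : 'I_n * 'I_n => Pair (Atom e.1) (Atom e.2)) es) RW).
rewrite {}Ecs {}Eb.
have cand r1 x1 r2 x2 : r1 \in R -> x1 \notin R -> r2 \in R -> x2 \notin R ->
    ((r1, x1), (r2, x2)) \in [seq (c1, c2) | c1 <- cs, c2 <- cs].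
  by move=> r1R x1R r2R x2R; apply: allpairs_f; rewrite csP /= ?r1R ?r2R ?x1R.
have distN r x : r \in R -> x \notin R -> dist w r x = w [set r; x].
  by move=> rR xR; rewrite /dist ifN //; apply: contraNneq xR => <-.
case: b bP => [[[r1 x1] [r2 x2]]|] bP; last first.
  have [x1 [x2 [x1R x2R x12]]] := card_gt1P R2; rewrite !inE in x1R x2R.
  (* Two distinct terminals, matched with the nonterminals [x1] and [x2], would form an admissible
     pair. *)
  have R1 r r' : r \in R -> r' \in R -> r = r'.
    move=> rR r'R; apply/eqP; apply: contraT => rr'.
    by have := bP _ (cand _ _ _ _ rR x1R r'R x2R); rewrite /valid_pair /= rr' x12.
  have [r Er Rr] : exists2 r : 'I_n, val_hd (val_hd (enc_seq (fun p : 'I_n * 'I_n =>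
      Pair (Atom p.1) (Pair (Atom p.2) (enc_rat (dist w p.1 p.2)))) cs)) = Atom r &
      R \subset [set r].
    (* An empty candidate list means that there is no terminal, since any terminal would be listed
       with [x1]. *)
    case: (cs) csP => [|[r x] cs'] csP'.
      exists (Ordinal nverts_gt0) => //; apply/subsetP => r rR.
      by have := csP' (r, x1); rewrite /= rR x1R.
    exists r => //; apply/subsetP => r' r'R; rewrite inE; apply/eqP/R1 => //.
    by have := csP' (r, x); rewrite mem_head => /esym/andP[].
  have [h1 h2 h3] := single_vertexP w Rr.
  exists (path_graph [:: r]); [split=> //|by right].
  by rewrite /vresult /= Er; apply: (vgraph_represents r [::]).
have [cb vb mb] := bP.
have [c1 c2] : (r1, x1) \in cs /\ (r2, x2) \in cs.
  move/allpairsP: cb => [[a b] /= [ha hb E]].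
  by have [-> ->] : (r1, x1) = a /\ (r2, x2) = b := conj (congr1 fst E) (congr1 snd E).
move: c1 c2; rewrite !csP /= => /andP[r1R x1R] /andP[r2R x2R].
have /andP[/= r12 x12] := vb.
have [gg gT] := growP cT (subsetP RT _ r2R) Tes (eq_leq (card_ord n)).
have [h1 h2 h3] := closed_pathP wM (And4 sT cT aT RT) gg gT r1R r2R r12 x1R x2R x12.
exists (path_graph (closed_path (tour (iter n (grow_round es) [:: (r2, r2)]) r1) r2 x1 x2)).
  split; last by split.
  rewrite /vresult /=; rewrite /vif /=.
  have -> : RW = enc_seq (fun i : 'I_n => enc_seq (fun j => enc_rat (dist w i j)) (enum 'I_n))
      (enum 'I_n) by [].
  by rewrite vgrowE size_enum_ord vtourE vclosed_pathE; apply: vgraph_represents.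
left; exists ((r1, x1), (r2, x2)).
  by split=> //; rewrite /pair_cost !distN.
move=> r1' x1' r2' x2' r1R' x1R' r2R' x2R' r12' x12'.
rewrite -!distN //; apply: (mb ((r1', x1'), (r2', x2'))); first exact: cand.
by rewrite /valid_pair /= r12'.
Qed.

End Approximation.

(** The core of [Topt] is itself a Steiner tree, so it bounds the Steiner optimum from above, and
    its pendant edges compete with the pair [c]. *)
Lemma internal_approx (K : realType) (rho : K) (I : instance)
    (T S Topt : subgraph 'I_(nverts I)) c :
  (1 <= rho)%R -> valid ISMT I -> @feasible SMT I T ->
  (forall T', @optimal SMT I T' ->
    ratr (weight (@edge_weight I) T) <= rho * ratr (weight (@edge_weight I) T'))%R ->
  [/\ c.1.1 \in terminals I, c.2.1 \in terminals I & valid_pair c] ->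
  (weight (@edge_weight I) S <=
    2 * weight (@edge_weight I) T + pair_cost (dist (@edge_weight I)) c)%R ->
  (forall r1 x1 r2 x2, r1 \in terminals I -> x1 \notin terminals I ->
    r2 \in terminals I -> x2 \notin terminals I -> r1 != r2 -> x1 != x2 ->
    (pair_cost (dist (@edge_weight I)) c <=
      edge_weight [set r1; x1] + edge_weight [set r2; x2])%R) ->
  @feasible ISMT I Topt ->
  (ratr (weight (@edge_weight I) S) <= 2 * rho * ratr (weight (@edge_weight I) Topt))%R.
Proof.
move=> rho1 [wM _] fT Tap [r1R r2R /andP[r12 _]] hS hc [stO nlO].
have R2 : 1 < #|terminals I| by apply/card_gt1P; exists c.1.1, c.2.1.
have [S0 [r1 [r2 [x1 [x2 [stS0 [r1R' r2R' r12'] [x1R' x2R' x12'] hO]]]]]] :=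
  internal_lower_bound wM stO nlO R2.
have [Tm [fTm mTm]] := optimal_exists fT.
have h1 := Tap Tm (conj fTm mTm); have h2 := mTm S0 stS0.
have h3 := hc _ _ _ _ r1R' x1R' r2R' x2R' r12' x12'.
have h4 : (0 <= pair_cost (dist (@edge_weight I)) c)%R by rewrite addr_ge0 ?dist_ge0.
move: hS h1 h2 hO; rewrite -!(ler_rat K) !rmorphD !rmorphM /= ratr_nat.
move: h3 h4; rewrite -!(ler_rat K) !rmorphD rmorph0 /=.
set d := ratr _; set a := ratr (weight _ S); set b := ratr (weight _ T).
set e := ratr (weight _ Tm); set f := ratr (weight _ S0); set g := ratr (weight _ Topt).
set u := (ratr _ + ratr _)%R => h3 h4 h5 h6 h7 h8.
have h9 : (rho * e <= rho * f)%R by rewrite ler_wpM2l //; lra.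
have h10 : (u <= rho * u)%R by rewrite ler_peMl //; lra.
have h11 : (rho * (f + u) <= rho * g)%R by rewrite ler_wpM2l //; lra.
by rewrite mulrDr in h11; nra.
Qed.

Local Open Scope ring_scope.

Theorem theorem1 (R : realType) (rho : R) (hrho : 1 <= rho)
    (hSMT : poly_time_approx SMT rho) :
  poly_time_approx ISMT (2 * rho).
Proof.
have [P [c [k HP]]] := hSMT.
have [Q [K HQ]] := runs_then P polytime_vinternal.
have [K' HK'] : polyb (fun m => (c * m ^ k + c + m + 2) ^ K)%N by polyb.
(* The encoding has size m >= 1, so m + 2 <= 3m; the coefficient [3 ^ K'] turns a power of m + 2
   into one of m. *)
exists Q, (3 ^ K')%N, K' => I I_valid.
have [t [v [T [rP tP vT fT Tap]]]] := HP I (conj (nverts_gt0 I_valid) I_valid.1).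
have [t' rQ tQ] := HQ _ _ _ rP.
have [S [vS fS] hS] := vinternalP I_valid vT fT.
exists t', (vinternal (Pair (enc_instance I) v)), S; split=> //.
  apply: leq_trans tQ _; set m := bitsize _ in tP *.
  apply: leq_trans (_ : (c * m ^ k + c + m + 2) ^ K <= _)%N.
    by apply: leq_expW; rewrite -addn2 !leq_add2r.
  apply: leq_trans (HK' m) _; apply: leq_trans (leq_addr _ _).
  rewrite -expnMn; apply: leq_expW.
  by have := bitsize_gt0 (enc_instance I); rewrite -/m; lia.
move=> Topt [fO _]; case: hS => [[cc [hc1 hc2] hc3]|->].
  exact: internal_approx hrho I_valid fT Tap hc1 hc2 hc3 fO.
rewrite rmorph0; apply: mulr_ge0; first by apply: mulr_ge0; lra.
by rewrite ler0q; apply: weight_ge0; [exact: I_valid.1|case: fO => -[]].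
Qed.
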